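(* Assume that the following hypotheses hold (notation in context): the generator $\mathcal{L}$ is self-adjoint in $L^2(\nu)$; the Yaglom limit $\mu:=\lim_{t\to+\infty}T_t(\nu)$ exists, with a corresponding $\lambda>0$ such that $\lambda=-\lim_{t\to\infty}\frac1t\log P_\nu(\tau>t)$; the density $u:=d\mu/d\nu$ exists and belongs to $L^2(\nu)$, $u$ is a simple eigenfunction for $\lambda$, $u$ is positive $\nu$-a.s. on $\mathcal{A}^c$; and $$\frac{dT_t(\nu)}{d\nu}\longrightarrow u\quad\text{in }L^2(\nu)\text{ as }t\to\infty.$$ Then: (i) For every $f,g\in L^2(\nu)$, $$\lim_{t\to\infty}\frac{E_\nu\bigl[f(\eta_0)g(\eta_t)\mathbb{1}_{\{\tau>t\}}\bigr]}{P_\nu(\tau>t)}=\int f\,d\mu\int g\,d\mu .$$ (ii) For any probability measure $\pi$ with $d\pi/d\nu\in L^2(\nu)$ (and such that $T_t(\pi)$ is defined for all $t$, i.e. $P_\pi(\tau>t)>0$), $T_t(\pi)$ converges to $\mu$ weakly in $L^2(\nu)$ as $t\to\infty$, i.e. for every $f\in L^2(\nu)$, $\int f\,dT_t(\pi)\to\int f\,d\mu$.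
   Context: Setting: $(\eta_t)_{t\ge0}$ is a càdlàg Markov process on $\Omega=\{0,1\}^{\mathbb{Z}^d}$ with generator $\mathcal{L}$ and invariant probability measure $\nu$; $P_\eta$, $P_\nu$ denote its law started from $\eta$, resp. from $\nu$, and $E_\nu$ the expectation under $P_\nu$. $\mathcal{A}\subset\Omega$ is a local pattern, i.e. an event depending only on finitely many coordinates, and $\tau=\inf\{t:\eta_t\in\mathcal{A}\}$. For a probability measure $\pi$, $T_t(\pi)$ is the law of $\eta_t$ conditioned on $\{\tau>t\}$ when $\eta_0$ has law $\pi$. Killed semigroup: $\overline{S}_tf(\eta)=E_\eta[f(\eta_t)\mathbb{1}_{\{\tau>t\}}]$, a semigroup on $L^2(\nu)$-functions vanishing on $\mathcal{A}$, with generator $\overline{\mathcal{L}}$ (formally $\mathbb{1}_{\mathcal{A}^c}\mathcal{L}$). ''$u$ is a simple eigenfunction for $\lambda$'' means that $\overline{S}_tu=e^{-\lambda t}u$ $\nu$-a.s. for all $t\ge0$ (i.e. $\overline{\mathcal{L}}u=-\lambda u$) and that the corresponding eigenspace in $L^2(\nu)$ is one-dimensional, spanned by $u$. *)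

(* Defs.v *)
From HB Require Import structures.
From mathcomp Require Import all_boot all_order all_algebra.
From mathcomp Require Import all_classical all_reals all_analysis.
Set Implicit Arguments.
Unset Strict Implicit.
Unset Printing Implicit Defensive.
Import Order.TTheory GRing.Theory Num.Theory.
Import numFieldNormedType.Exports.
Local Open Scope classical_set_scope.
Local Open Scope ring_scope.

(* {0,1}^{Z^n}, a point of Z^n being a row vector of integers; it carries the
   product topology and the corresponding Borel sigma-algebra, which is also
   the product sigma-algebra since Z^n is countable. *)
Definition config (n : nat) : Type := {ptws 'rV[int]_n -> bool}.

HB.instance Definition _ n := Pointed.on (config n).
HB.instance Definition _ n := Topological.on (config n).
HB.instance Definition _ n :=
  Measurable.copy (config n) (g_sigma_algebraType (@open (config n))).

Record local_pattern (n : nat) := LocalPattern {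
  pattern : set (config n) ;
  pattern_local : exists S : seq 'rV[int]_n, forall eta xi : config n,
    {in S, eta =1 xi} -> pattern eta <-> pattern xi
}.

Section markov_process.
Context (R : realType) (n : nat) (dW : measure_display).
Context (W : measurableType dW).

Definition cadlag_path (x : R -> config n) :=
  (forall t, 0 <= t -> x s @[s --> t^'+] --> x t) /\
  (forall t, 0 < t -> exists l : config n, x s @[s --> t^'-] --> l).

(* The sigma-algebra generated by the coordinates up to time s. *)
Definition past (X : R -> W -> config n) (s : R) : set (set W) :=
  <<s [set B | exists r C, [/\ 0 <= r, r <= s, measurable C &
                              B = X r @^-1` C] ] >>.

(* A family of processes, one for each initial configuration, on a common
   sample space W. Only the coordinates at times t >= 0 are meaningful. *)
Record cadlag_markov_process := CadlagMarkovProcess {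
  state : R -> {mfun W >-> config n} ;
  Plaw : R.-pker (config n) ~> W ;
  state_cadlag : forall w, cadlag_path (state ^~ w) ;
  state_start : forall eta, {ae Plaw eta, forall w, state 0 w = eta} ;
  state_markov : forall (eta : config n) (s t : R) (B : set W)
      (C : set (config n)),
    0 <= s -> 0 <= t -> past state s B -> measurable C ->
    Plaw eta (B `&` state (s + t) @^-1` C) =
    (\int[Plaw eta]_(w in B) Plaw (state s w) (state t @^-1` C))%E
}.

End markov_process.

Section initial_law.
Local Open Scope ereal_scope.
Context (R : realType) (n : nat) (dW : measure_display).
Context (W : measurableType dW).
Context (Z : cadlag_markov_process R n W) (pi : probability (config n) R).

(* P_pi = \int P_eta pi(d eta) *)
Definition init_law (B : set W) : \bar R := \int[pi]_eta Plaw Z eta B.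

Let init_law0 : init_law set0 = 0.
Proof. by rewrite /init_law integral0_eq. Qed.

Let init_law_ge0 B : 0 <= init_law B.
Proof. exact: integral_ge0. Qed.

Let init_law_sigma_additive : semi_sigma_additive init_law.
Proof.
move=> U mU tU mUU; rewrite [X in _ --> X](_ : _ =
  \int[pi]_y (\sum_(k <oo) Plaw Z y (U k))); last first.
  apply: eq_integral => V _.
  by apply/esym/cvg_lim => //; exact/measure_semi_sigma_additive.
apply/cvg_closeP; split.
  by apply: is_cvg_nneseries => k _ _; exact: integral_ge0.
rewrite closeE// integral_nneseries// => k.
exact: measurable_kernel.
Qed.

HB.instance Definition _ := isMeasure.Build _ _ R init_law
  init_law0 init_law_ge0 init_law_sigma_additive.

Let init_lawT : init_law setT = 1.
Proof.
rewrite /init_law; under eq_integral do rewrite prob_kernel.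
by rewrite integral_cst//= mul1e probability_setT.
Qed.

HB.instance Definition _ := Measure_isProbability.Build _ _ R init_law init_lawT.

End initial_law.

Section conditioning.
Context (R : realType) (n : nat) (dW : measure_display).
Context (W : measurableType dW).
Context (Z : cadlag_markov_process R n W) (A : local_pattern n).

(* tau = inf {t >= 0 : eta_t \in A}, with inf of the empty set = +oo *)
Definition hitting_time (w : W) : \bar R :=
  ereal_inf [set s%:E | s in [set s : R | 0 <= s /\ pattern A (state Z s w)]].

Definition survival (t : R) : set W := [set w | (t%:E < hitting_time w)%E].

Let cylinder_nbhs (S : seq 'rV[int]_n) (eta : config n) :
  \forall xi \near eta, {in S, eta =1 xi}.
Proof.
elim: S => [|x S IH]; first by near=> xi => y.
have hx : \forall xi \near eta, (xi : config n) x = eta x.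
  have /(_ (fun b => b = eta x)) := @proj_continuous _ (fun=> bool) x eta.
  by apply; apply/principal_filterP.
near=> xi => y; rewrite inE => /orP[/eqP ->|yS].
  by apply/esym; near: xi.
by move: y yS; near: xi.
Unshelve. all: by end_near. Qed.

Lemma pattern_near (eta : config n) :
  \forall xi \near eta, pattern A eta <-> pattern A xi.
Proof.
have [S hS] := pattern_local A.
by near=> xi; apply: hS; near: xi; exact: cylinder_nbhs.
Unshelve. all: by end_near. Qed.

Lemma open_pattern : open (pattern A).
Proof.
rewrite openE => eta Aeta; apply: filterS (pattern_near eta) => xi h.
exact/h.
Qed.

Lemma measurable_pattern : measurable (pattern A).
Proof. by apply: sub_sigma_algebra; exact: open_pattern. Qed.

Let pattern_right (w : W) (t : R) : 0 <= t ->
  exists2 e : R, 0 < e & forall s, t < s -> s < t + e ->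
    pattern A (state Z t w) <-> pattern A (state Z s w).
Proof.
move=> t0; have := (state_cadlag Z w).1 t t0 _ (pattern_near (state Z t w)).
rewrite /= /at_right /within /= => -[e /= e0 h].
exists e => // s ts se; apply: (h s) => //=.
by rewrite ltr_distl ltrBlDr se ltr_wpDr// ltW.
Qed.

Lemma survivalP (t : R) (w : W) :
  survival t w <-> (forall s, 0 <= s -> s <= t -> ~ pattern A (state Z s w)).
Proof.
split=> [tw s s0 st As|h].
  have : (hitting_time w <= s%:E)%E by apply: ereal_inf_lbound; exists s.
  by move/(lt_le_trans tw); rewrite lte_fin ltNge st.
rewrite /survival /=; have [t0|t0] := ltP t 0.
  apply: (@lt_le_trans _ _ 0%E); first by rewrite lte_fin.
  by apply: le_ereal_inf_tmp => _ [s [s0 _] <-]; rewrite lee_fin.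
have [e e0 he] := pattern_right w t0.
apply: (@lt_le_trans _ _ (t + e)%:E); first by rewrite lte_fin ltrDl.
apply: le_ereal_inf_tmp => _ [s [s0 As] <-]; rewrite lee_fin leNgt.
apply/negP => se; have [st|ts] := leP s t; first exact: (h s).
by apply: (h t) => //; apply/(he s).
Qed.

Lemma measurable_survival (t : R) : measurable (survival t).
Proof.
have [t0|t0] := ltP t 0.
  rewrite (_ : survival t = setT)//; apply/seteqP; split=> // w _.
  by apply/survivalP => s s0 /le_lt_trans/(_ t0); rewrite ltNge s0.
have mA s : measurable (state Z s @^-1` pattern A).
  rewrite -[X in measurable X]setTI.
  by apply: measurable_funPT => //; exact: measurable_pattern.
have -> : survival t = ~` (state Z t @^-1` pattern A) `&`
  \bigcap_(q in [set q : rat | 0 <= (ratr q : R) <= t])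
    ~` (state Z (ratr q) @^-1` pattern A); last first.
  apply: measurableI; first exact/measurableC/mA.
  rewrite -setC_bigcup bigcup_mkcond; apply: measurableC.
  by apply: bigcupT_measurable_rat => q; case: ifP.
apply/seteqP; split=> w.
  move=> /survivalP h; split; first exact: h.
  by move=> q /andP[q0 qt]; exact: h.
move=> [/= ht hq]; apply/survivalP => s s0; rewrite le_eqVlt.
move=> /orP[/eqP -> //|st] As.
have [e e0 he] := pattern_right w s0.
have /rat_in_itvoo[q] : s < Num.min t (s + e) by rewrite lt_min st ltrDl.
rewrite in_itv/= lt_min => /and3P[sq qt qe].
apply: (hq q); first by rewrite /= (ltW qt) (ltW (le_lt_trans s0 sq)).
by apply/(he _ sq qe).
Qed.

(* P_pi( . | tau > t); mnormalize returns the junk value P_pi in the case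
   P_pi(tau > t) = 0, where the conditioning is undefined. *)
Definition survival_law (t : R) (pi : probability (config n) R)
    : probability W R :=
  mnormalize (mrestr (init_law Z pi) (measurable_survival t)) (init_law Z pi).

(* T_t(pi) *)
Definition cond_law (t : R) (pi : probability (config n) R)
    : probability (config n) R :=
  distribution (survival_law t pi) (state Z t).

Definition semigroup (t : R) (f : config n -> R) (eta : config n) : R :=
  \int[Plaw Z eta]_w f (state Z t w).

Definition killed_semigroup (t : R) (f : config n -> R) (eta : config n) : R :=
  \int[Plaw Z eta]_(w in survival t) f (state Z t w).

End conditioning.

Section L2.
Local Open Scope charge_scope.
Context (R : realType) (d : measure_display) (T : measurableType d).
Context (nu : probability T R).

Definition L2norm (f : T -> R) : \bar R := 'N[nu]_2%:E[EFin \o f].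

Definition L2dot (f g : T -> R) : R := \int[nu]_x (f x * g x).

(* An unbounded operator on L^2(nu) is represented by its graph. *)
Definition L2_self_adjoint (G : (T -> R) -> (T -> R) -> Prop) :=
  (forall f, f \in Lfun nu 2%:E -> forall e : R, 0 < e ->
     exists g h, G g h /\ (L2norm (f \- g)%R < e%:E)%E) /\
  (forall g h, g \in Lfun nu 2%:E -> h \in Lfun nu 2%:E ->
     (forall f k, G f k -> L2dot k g = L2dot f h) <-> G g h).

Definition density (m : probability T R) (x : T) : R :=
  fine ('d (charge_of_finite_measure m) '/d nu x).

End L2.

Section hypotheses.
Context (R : realType) (n : nat) (dW : measure_display).
Context (W : measurableType dW).
Context (Z : cadlag_markov_process R n W) (nu : probability (config n) R).

Definition invariant_measure :=
  forall t (B : set (config n)), 0 <= t -> measurable B ->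
    init_law Z nu (state Z t @^-1` B) = nu B.

(* Graph of the generator of the semigroup on L^2(nu): generator f h means
   that f is in the domain and that h is (a version of) L f. *)
Definition generator (f h : config n -> R) :=
  [/\ f \in Lfun nu 2%:E, h \in Lfun nu 2%:E &
    L2norm nu (fun eta => (semigroup Z t f eta - f eta) / t - h eta)
      @[t --> (0 : R)^'+] --> 0%E].

Definition killed_eigenfunction (A : local_pattern n) (lam : R)
    (v : config n -> R) :=
  v \in Lfun nu 2%:E /\
  forall t, 0 <= t ->
    {ae nu, forall eta, killed_semigroup Z A t v eta = expR (- lam * t) * v eta}.

Definition simple_eigenfunction (A : local_pattern n) (lam : R)
    (u : config n -> R) :=
  [/\ killed_eigenfunction A lam u, ~ {ae nu, forall eta, u eta = 0} &
    forall v, killed_eigenfunction A lam v ->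
      exists c : R, {ae nu, forall eta, v eta = c * u eta}].

End hypotheses.

(* Main.v *)
(* The self-adjoint generator makes the process reversible under nu. Survival up to
   time t is the decreasing limit, by right-continuity, of survival along the dyadic
   grids of [0, t], so the Markov property and reversibility give that the killed
   semigroup K_t is a semigroup and is symmetric on L^2(nu).

   Since <dT_t(nu)/dnu, u> = exp(- lam t) / P_nu(tau > t), the L^2 convergence of the
   densities gives P_nu(tau > t) <= C exp(- lam t) for large t. For bounded f,
   |K_t f|^2 is at most a constant times P_nu(tau > 2 t), and log-convexity of
   t |-> |K_t f| upgrades this to |K_t f| <= exp(- lam t) |f|, then for all f by
   density. Hence M_t = exp(lam t) K_t is a symmetric contraction semigroup, M_t f
   converges in L^2(nu) to a fixed point of M, and simplicity of u identifies the
   limit as <f, u> u / |u|^2. Both claims are quotients of limits of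
   exp(lam t) <f, K_t g>. *)
Require Import Defs.
From HB Require Import structures.
From mathcomp Require Import all_boot all_order all_algebra.
From mathcomp Require Import all_classical all_reals all_analysis.
From mathcomp Require Import measurable_realfun ring lra.
Import Order.TTheory GRing.Theory Num.Theory.
Import numFieldNormedType.Exports.
Local Open Scope classical_set_scope.
Local Open Scope ring_scope.

Set SsrOldRewriteGoalsOrder.
Set Implicit Arguments.
Unset Strict Implicit.
Unset Printing Implicit Defensive.

(** * Mixtures of measures *)

(** The Markov property is available at deterministic times, for events of [past], whereas survival
    involves uncountably many times. Along a grid the killed operator is 1 P 1 P ... P 1, with P the
    transition over one step and 1 the restriction to the complement of the pattern. This word is a
    palindrome, hence symmetric as soon as P is.

    No spectral theory is used. Symmetry of the semigroup comes from moving short time steps from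
    one side of <S_s f, S_r g> to the other. Decay comes from |K_t f|^2 = <f, K_2t f> <= |f| |K_2t
    f|, iterated along t, 2t, 4t, ...: doubling washes out every constant prefactor, so that exp(lam
    t) K_t is a true contraction.

    Elements of L^2 are functions here, not classes, and the integral defining K_t f may diverge at
    some configurations. Identities are first proved for nonnegative extended real functions, at
    every configuration, and reach L^2 through positive and negative parts, almost everywhere.

    In (ii) the denominator tends to <h, u>, up to normalization, with h the density of pi. It is
    nonzero because u > 0 off the pattern and P_pi(tau > 0) > 0. *)

Section mixture.
Local Open Scope ereal_scope.
Context (R : realType) d d' (Y : measurableType d) (T : measurableType d').
Context (m : {measure set Y -> \bar R}) (l : Y -> {measure set T -> \bar R}).
Context (D : set Y) (mD : measurable D) (m' : {measure set T -> \bar R}).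
Context (ml : forall U, measurable U -> measurable_fun [set: Y] (fun y => l y U)).
Context (m'E : forall U, measurable U -> m' U = \int[m]_(y in D) l y U).
Import HBNNSimple.

Let mixture_nnsfun (f : {nnsfun T >-> R}) :
  \int[m']_x (f x)%:E = \int[m]_(y in D) \int[l y]_x (f x)%:E.
Proof.
have mlf r : measurable_fun D (fun y => l y (f @^-1` [set r])).
  by apply: measurable_funTS; exact: ml.
rewrite integralT_nnsfun sintegralE.
under [RHS]eq_integral do rewrite integralT_nnsfun sintegralE.
rewrite ge0_integral_fsum//; last 2 first.
  - by move=> r; exact: measurable_funeM.
  - by move=> r y Dy; exact: nnsfun_mulemu_ge0.
apply: eq_fsbigr => r _; rewrite m'E//.
have [r0|r0] := leP 0%R r; first by rewrite ge0_integralZl//.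
rewrite integral0_eq ?mule0; last first.
  by move=> y _; rewrite preimage_nnfun0.
by rewrite integral0_eq// => y _; rewrite preimage_nnfun0// measure0 mule0.
Qed.

(** The Markov property, [init_law] and the killed laws are all given by their values on sets; this
    lemma carries such formulas over to nonnegative functions. *)
Lemma ge0_integral_mixture (f : T -> \bar R) :
  (forall x, 0 <= f x) -> measurable_fun setT f ->
  \int[m']_x f x = \int[m]_(y in D) \int[l y]_x f x.
Proof.
move=> f0 mf.
pose f_ := nnsfun_approx measurableT mf.
have f_0 n x : 0 <= (f_ n x)%:E by rewrite lee_fin.
have mf_ n : measurable_fun setT (fun x => (f_ n x)%:E) by exact/measurable_EFinP.
have ndf x : {homo (fun n => (f_ n x)%:E) : a b / (a <= b)%N >-> a <= b}.
  by move=> a b ab; rewrite lee_fin; exact/lefP/nd_nnsfun_approx.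
have limf (k : {measure set T -> \bar R}) :
    \int[k]_x f x = limn (fun n => \int[k]_x (f_ n x)%:E).
  rewrite -monotone_convergence//.
  by apply: eq_integral => x _; apply/esym/cvg_lim => //; exact: cvg_nnsfun_approx.
rewrite limf; under eq_fun do rewrite mixture_nnsfun.
under [RHS]eq_integral do rewrite limf.
rewrite monotone_convergence//.
- by move=> n; apply: measurable_funTS; exact: measurable_fun_integral_kernel.
- by move=> n y _; exact: integral_ge0.
- by move=> y _ a b ab; apply: ge0_le_integral => // x _; exact: ndf.
Qed.

End mixture.

Section restriction.
Local Open Scope ereal_scope.
Context (R : realType) d (T : measurableType d) (m : {measure set T -> \bar R}).
Context (D : set T) (mD : measurable D).

(** The restriction of [m] to [D] is the mixture over [D] of the Dirac masses. *)
Lemma ge0_integral_mrestr (f : T -> \bar R) :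
  (forall x, 0 <= f x) -> measurable_fun setT f ->
  \int[mrestr m mD]_x f x = \int[m]_(x in D) f x.
Proof.
move=> f0 mf; rewrite (@ge0_integral_mixture _ _ _ _ _ m (fun y => \d_y) D)//=.
- by apply: eq_integral => y _; rewrite integral_dirac// diracT mul1e.
- by move=> U mU; apply/measurable_EFinP; exact: measurable_indic.
- by move=> U mU; rewrite integral_indic// /mrestr.
Qed.

End restriction.

(** * The Markov property and killing *)

Section killed.
Local Open Scope ereal_scope.
Context (R : realType) (n : nat) (dW : measure_display) (W : measurableType dW).
Context (Z : cadlag_markov_process R n W).
Implicit Types (A : local_pattern n) (F G : config n -> \bar R) (eta : config n).

(** Extended real counterparts of [semigroup] and [killed_semigroup]: on nonnegative functions they
    require no integrability, so identities hold at every [eta]. [Kr_killE] relates them to the real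
    versions. *)
Definition transition t F eta : \bar R := \int[Plaw Z eta]_w F (state Z t w).

Definition killed_transition A t F eta : \bar R :=
  \int[Plaw Z eta]_(w in survival Z A t) F (state Z t w).

Lemma measurable_state_pre t (C : set (config n)) : measurable C ->
  measurable (state Z t @^-1` C).
Proof.
by move=> mC; rewrite -[X in measurable X]setTI; exact: measurable_funPT.
Qed.

Lemma measurable_state_comp t F : measurable_fun setT F ->
  measurable_fun setT (F \o state Z t).
Proof. by move=> mF; exact: measurableT_comp. Qed.

Lemma measurable_past s (B : set W) : past (state Z) s B -> measurable B.
Proof.
move: B; apply: smallest_sub; first exact: sigma_algebra_measurable.
by move=> _ [r [C [r0 rs mC ->]]]; exact: measurable_state_pre.
Qed.

Lemma past_state s r (C : set (config n)) : (0 <= r)%R -> (r <= s)%R ->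
  measurable C -> past (state Z) s (state Z r @^-1` C).
Proof. by move=> r0 rs mC; apply: sub_gen_smallest; exists r, C. Qed.

Lemma pastC s (B : set W) : past (state Z) s B -> past (state Z) s (~` B).
Proof.
move=> pB; have [_ h _] := smallest_sigma_algebra setT
  [set B | exists r C, [/\ 0 <= r, r <= s, measurable C &
                              B = state Z r @^-1` C] ]%R.
by rewrite -setTD; exact: h.
Qed.

Lemma past0 s : past (state Z) s set0.
Proof. by have [] := smallest_sigma_algebra setT
  [set B | exists r C, [/\ 0 <= r, r <= s, measurable C &
                              B = state Z r @^-1` C] ]%R. Qed.

Lemma pastT s : past (state Z) s setT.
Proof. by have := pastC (@past0 s); rewrite setC0. Qed.

Lemma past_bigcup s (B : nat -> set W) : (forall i, past (state Z) s (B i)) ->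
  past (state Z) s (\bigcup_i B i).
Proof.
move=> pB; have [_ _ h] := smallest_sigma_algebra setT
  [set B | exists r C, [/\ 0 <= r, r <= s, measurable C &
                              B = state Z r @^-1` C] ]%R.
exact: h.
Qed.

Lemma past_bigcap s (B : nat -> set W) : (forall i, past (state Z) s (B i)) ->
  past (state Z) s (\bigcap_i B i).
Proof.
move=> pB; rewrite -(setCK (\bigcap_i _)) setC_bigcap; apply: pastC.
by apply: past_bigcup => i; exact: pastC.
Qed.

Lemma pastI s (B C : set W) : past (state Z) s B -> past (state Z) s C ->
  past (state Z) s (B `&` C).
Proof.
move=> pB pC; rewrite -bigcap2E; apply: past_bigcap => -[|[|i]]//=.
exact: pastT.
Qed.

Lemma past_le s s' (B : set W) : (s <= s')%R -> past (state Z) s B ->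
  past (state Z) s' B.
Proof.
move=> ss'; move: B; apply: sub_smallest2r; first exact: smallest_sigma_algebra.
by move=> _ [r [C [r0 rs mC ->]]]; exists r, C; split => //; exact: le_trans ss'.
Qed.

Lemma trans_ge0 t F eta : (forall x, 0 <= F x) -> 0 <= transition t F eta.
Proof. by move=> F0; exact: integral_ge0. Qed.

Lemma kill_ge0 A t F eta : (forall x, 0 <= F x) -> 0 <= killed_transition A t F eta.
Proof. by move=> F0; exact: integral_ge0. Qed.

Lemma measurable_trans t F : (forall x, 0 <= F x) -> measurable_fun setT F ->
  measurable_fun setT (transition t F).
Proof.
move=> F0 mF; apply: measurable_fun_integral_kernel => //.
  by move=> U mU; exact: measurable_kernel.
exact: measurable_state_comp.
Qed.

Lemma measurable_kill A t F : (forall x, 0 <= F x) -> measurable_fun setT F ->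
  measurable_fun setT (killed_transition A t F).
Proof.
move=> F0 mF; rewrite /killed_transition; under eq_fun do rewrite integral_mkcond.
apply: measurable_fun_integral_kernel => //.
- by move=> U mU; exact: measurable_kernel.
- by move=> w; rewrite patchE; case: ifP.
- apply/(measurable_restrictT _ (measurable_survival Z A t)).
  by apply: measurable_funTS; exact: measurable_state_comp.
Qed.

(** By [state_markov], the law of [state (s + t)] on [B] is the mixture over w in [B] of the laws of
    [state t] under [Plaw (state s w)]. *)
Lemma markov_ge0 eta s t (B : set W) F : (0 <= s)%R -> (0 <= t)%R ->
  past (state Z) s B -> (forall x, 0 <= F x) -> measurable_fun setT F ->
  \int[Plaw Z eta]_(w in B) F (state Z (s + t)%R w) =
  \int[Plaw Z eta]_(w in B) transition t F (state Z s w).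
Proof.
move=> s0 t0 pB F0 mF.
have mB := measurable_past pB.
have mX r : measurable_fun setT (state Z r) by exact: measurable_funPT.
rewrite -(@ge0_integral_mrestr _ _ _ (Plaw Z eta) B mB)//; last exact: measurable_state_comp.
have <- := @ge0_integral_pushforward _ _ _ _ R _ (mX (s + t)%R) (mrestr (Plaw Z eta) mB) setT F
   measurableT mF (fun y _ => F0 y).
rewrite (@ge0_integral_mixture _ _ _ _ _ (Plaw Z eta)
  (fun w => pushforward (Plaw Z (state Z s w)) (state Z t)) B)//=.
- apply: eq_integral => w _.
  by rewrite ge0_integral_pushforward.
- move=> U mU; apply: (measurableT_comp (measurable_kernel (Plaw Z) _ _)) => //.
  exact: measurable_state_pre.
- move=> U mU; rewrite -state_markov// /pushforward /mrestr setIC//.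
Qed.

End killed.

(** * Survival along time grids and its dyadic limit *)

Section grid.
Local Open Scope ereal_scope.
Context (R : realType) (n : nat) (dW : measure_display) (W : measurableType dW).
Context (Z : cadlag_markov_process R n W) (A : local_pattern n).
Implicit Types (F G : config n -> \bar R) (eta : config n).

(** The grid starts at [s] so that it can be combined with an event of the past of [s], in
    particular with survival up to [s]. *)
Definition alive_on_grid (s h : R) (N : nat) : set W :=
  [set w | forall k, (k <= N)%N -> ~ pattern A (state Z (s + k%:R * h)%R w)].

(** A step kills at its end only; [grid] adds the restriction at the initial time, which makes the
    product of operators a palindrome. *)
Definition grid_step (h : R) F := transition Z h (F \_ (~` pattern A)).

(* grid h N F eta = E_eta[F(eta_{Nh}); eta_{kh} not in A for k <= N]; see
   integral_alive_on_grid. *)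
Definition grid (h : R) (N : nat) F := (iter N (grid_step h) F) \_ (~` pattern A).

Let mAc : measurable (~` pattern A).
Proof. by apply: measurableC; exact: measurable_pattern. Qed.

Let restr_ge0 F : (forall x, 0 <= F x) -> forall x, 0 <= (F \_ (~` pattern A)) x.
Proof. by move=> F0 x; rewrite patchE; case: ifP => _ //; exact: F0. Qed.

Let measurable_restr F : measurable_fun setT F ->
  measurable_fun setT (F \_ (~` pattern A)).
Proof. by move=> mF; apply/(measurable_restrictT _ mAc); exact: measurable_funTS. Qed.

Lemma grid_step_ge0 h F : (forall x, 0 <= F x) -> forall x, 0 <= grid_step h F x.
Proof. by move=> F0 x; apply: trans_ge0; exact: restr_ge0. Qed.

Lemma measurable_grid_step h F : (forall x, 0 <= F x) -> measurable_fun setT F ->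
  measurable_fun setT (grid_step h F).
Proof.
by move=> F0 mF; apply: measurable_trans; [exact: restr_ge0|exact: measurable_restr].
Qed.

Lemma iter_grid_step_ge0 h N F : (forall x, 0 <= F x) ->
  forall x, 0 <= iter N (grid_step h) F x.
Proof. by move=> F0; elim: N => //= N IH; exact: grid_step_ge0. Qed.

Lemma measurable_iter_grid_step h N F : (forall x, 0 <= F x) -> measurable_fun setT F ->
  measurable_fun setT (iter N (grid_step h) F).
Proof.
move=> F0 mF; elim: N => //= N IH; apply: measurable_grid_step => //.
exact: iter_grid_step_ge0.
Qed.

Lemma grid_ge0 h N F : (forall x, 0 <= F x) -> forall x, 0 <= grid h N F x.
Proof. by move=> F0; apply: restr_ge0; exact: iter_grid_step_ge0. Qed.

Lemma measurable_grid h N F : (forall x, 0 <= F x) -> measurable_fun setT F ->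
  measurable_fun setT (grid h N F).
Proof. by move=> F0 mF; apply: measurable_restr; exact: measurable_iter_grid_step. Qed.

Lemma past_alive_on_grid s h N : (0 <= s)%R -> (0 <= h)%R ->
  past (state Z) (s + N%:R * h)%R (alive_on_grid s h N).
Proof.
move=> s0 h0.
have -> : alive_on_grid s h N = \bigcap_k (if (k <= N)%N then
    state Z (s + k%:R * h)%R @^-1` (~` pattern A) else setT).
  apply/seteqP; split => w.
    by move=> aw k _; case: ifPn => // /aw.
  by move=> aw k kN; have := aw k I; rewrite kN.
apply: past_bigcap => k; case: ifPn => kN; last exact: pastT.
apply: past_state => //; first by rewrite addr_ge0// mulr_ge0.
by rewrite lerD2l ler_wpM2r// ler_nat.
Qed.

(** Induction on [N] for all [F] at once: the Markov property at the last but one grid time replaces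
    [F] by [grid_step h F] and leaves an event with one time fewer. *)
Lemma integral_alive_on_grid eta s h N (B : set W) F : (0 <= s)%R -> (0 <= h)%R ->
  past (state Z) s B -> (forall x, 0 <= F x) -> measurable_fun setT F ->
  \int[Plaw Z eta]_(w in B `&` alive_on_grid s h N) F (state Z (s + N%:R * h)%R w) =
  \int[Plaw Z eta]_(w in B) grid h N F (state Z s w).
Proof.
move=> s0 h0 pB; elim: N F => [|N IH] F F0 mF.
  have -> : alive_on_grid s h 0 = state Z s @^-1` (~` pattern A).
    apply/seteqP; split => w /=.
      by move=> /(_ 0%N isT); rewrite mul0r addr0.
    by move=> Aw k; rewrite leqn0 => /eqP ->; rewrite mul0r addr0.
  rewrite mul0r addr0 integral_mkcondr; apply: eq_integral => w _.
  by rewrite /grid /= !patchE.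
have -> : B `&` alive_on_grid s h N.+1 = (B `&` alive_on_grid s h N) `&`
    state Z (s + N.+1%:R * h)%R @^-1` (~` pattern A).
  apply/seteqP; split => w.
    move=> [Bw aw]; split; last exact: aw.
    by split => // k kN; apply: aw; exact: leqW.
  move=> [[Bw aw] lw]; split => // k; rewrite leq_eqVlt => /orP[/eqP ->//|].
  exact: aw.
rewrite integral_mkcondr /=.
transitivity (\int[Plaw Z eta]_(w in B `&` alive_on_grid s h N)
    (F \_ (~` pattern A)) (state Z (s + N.+1%:R * h)%R w)).
  by apply: eq_integral => w _; rewrite !patchE.
rewrite -natr1 mulrDl mul1r addrA.
rewrite markov_ge0//; last 4 first.
- by rewrite addr_ge0// mulr_ge0.
- apply: pastI; last exact: past_alive_on_grid.
  by apply: past_le pB; rewrite lerDl mulr_ge0.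
- exact: restr_ge0.
- exact: measurable_restr.
rewrite (IH (grid_step h F)); last 2 first.
- exact: grid_step_ge0.
- exact: measurable_grid_step.
by rewrite /grid -iterSr.
Qed.

(** A local pattern is both open and closed, so right-continuity of the path preserves membership
    for a short time. *)
Let pattern_right (w : W) (t : R) : (0 <= t)%R ->
  exists2 e : R, (0 < e)%R & forall s, (t < s)%R -> (s < t + e)%R ->
    pattern A (state Z t w) <-> pattern A (state Z s w).
Proof.
move=> t0; have := (state_cadlag Z w).1 t t0 _ (pattern_near A (state Z t w)).
rewrite /= /at_right /within /= => -[e /= e0 h].
exists e => // s ts se; apply: (h s) => //=.
by rewrite ltr_distl ltrBlDr se ltr_wpDr// ltW.
Qed.

Let mesh (t : R) (m : nat) : R := (t / (2 ^ m)%:R)%R.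

Lemma mesh_ge0 t m : (0 <= t)%R -> (0 <= mesh t m)%R.
Proof. by move=> t0; rewrite divr_ge0. Qed.

Lemma meshE t m : ((2 ^ m)%:R * mesh t m = t)%R.
Proof. by rewrite /mesh mulrC divfK// pnatr_eq0 -lt0n expn_gt0. Qed.

(** A path that is in the pattern at a time [r] stays there during some interval to the right of
    [r], and a fine enough dyadic grid has a point in that interval. *)
Lemma survivalD s t : (0 <= s)%R -> (0 <= t)%R -> survival Z A (s + t)%R =
  survival Z A s `&` \bigcap_m alive_on_grid s (mesh t m) (2 ^ m).
Proof.
move=> s0 t0; apply/seteqP; split => w.
  move=> /survivalP sw; split.
    by apply/survivalP => r r0 rs; apply: sw => //; rewrite (le_trans rs)// lerDl.
  move=> m _ k km; apply: sw.
    by rewrite addr_ge0// mulr_ge0// mesh_ge0.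
  rewrite lerD2l -[leRHS](meshE _ m) ler_wpM2r ?mesh_ge0// ler_nat//.
move=> [/survivalP sw aw]; apply/survivalP => r r0 rst.
have [rs|sr] := leP r s; first exact: sw.
move: rst; rewrite le_eqVlt => /orP[/eqP ->|rst].
  (* The end [s + t] is the last point of the coarsest grid: [m = 0] and [k = 1]. *)
  by have := aw 0%N I 1%N (leqnn _); rewrite mul1r /mesh expn0 divr1.
have tgt0 : (0 < t)%R by have := lt_trans sr rst; rewrite ltrDl.
have [e e0 he] := pattern_right w r0.
have [m hm] : exists m, (mesh t m < e)%R.
  exists (Num.truncn (t / e)); rewrite /mesh ltr_pdivrMr ?ltr0n ?expn_gt0//.
  rewrite mulrC -ltr_pdivrMr// (lt_le_trans (truncnS_gt _))// ler_nat.
  exact: ltn_expl.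
have m0 : (0 < mesh t m)%R by rewrite divr_gt0// ltr0n expn_gt0.
set x := ((r - s) / mesh t m)%R.
have x0 : (0 <= x)%R by rewrite divr_ge0 ?ltW// subr_gt0.
have k_lt : (x < (Num.truncn x).+1%:R)%R by exact: truncnS_gt.
have k_ge : ((Num.truncn x)%:R <= x)%R by rewrite truncn_le.
have rE : (r = s + x * mesh t m)%R by rewrite /x divfK ?gt_eqF// addrC subrK.
(* This is the first grid time strictly after [r]. It exceeds [r] by at most the mesh, which is
   below [e], so the path is still in the pattern. *)
move=> Ar; apply: (aw m I (Num.truncn x).+1); last first.
  apply/(he _ _ _) => //.
    by rewrite [X in (X < _)%R]rE ltrD2l ltr_pM2r.
  rewrite [X in (_ < X + _)%R]rE -addrA ltrD2l -natr1 mulrDl mul1r.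
  by rewrite ler_ltD// ler_wpM2r// ltW.
rewrite -(ltr_nat R) (le_lt_trans k_ge)// /x ltr_pdivrMr// meshE.
by rewrite ltrBlDl.
Qed.

Lemma alive_on_grid_nincr s t m m' : (m <= m')%N ->
  alive_on_grid s (mesh t m') (2 ^ m') `<=` alive_on_grid s (mesh t m) (2 ^ m).
Proof.
move=> mm' w aw k km.
have meshM : mesh t m = ((2 ^ (m' - m))%:R * mesh t m')%R.
  have h2 : (2 ^ m)%:R != 0%R :> R by rewrite pnatr_eq0 -lt0n expn_gt0.
  by apply: (mulfI h2); rewrite meshE mulrA -natrM -expnD subnKC// meshE.
rewrite meshM mulrA -natrM; apply: aw.
by rewrite -[X in (_ <= 2 ^ X)%N](subnKC mm') expnD leq_pmul2r ?expn_gt0.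
Qed.

Lemma survival0 : survival Z A 0 = state Z 0 @^-1` (~` pattern A).
Proof.
apply/seteqP; split => w; first by move=> /survivalP; apply.
by move=> Aw; apply/survivalP => s s0 sl0; rewrite (@le_anti _ _ s 0%R) ?sl0.
Qed.

(** [survivalD] from time 0 turns the condition on uncountably many times into a countable
    intersection of grid events. *)
Lemma past_survival s : (0 <= s)%R -> past (state Z) s (survival Z A s).
Proof.
move=> s0; rewrite -[X in survival Z A X]add0r survivalD// survival0.
apply: pastI; first exact: past_state.
apply: past_bigcap => m.
have := @past_alive_on_grid 0%R (mesh s m) (2 ^ m) (lexx _) (mesh_ge0 _ s0).
by rewrite meshE add0r.
Qed.

(** The integral is the probability of surviving up to [s], then along the grid, and of ending in
    [C]. These events decrease as the mesh is halved, so continuity from above applies. *)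
Lemma cvg_integral_grid eta s t (C : set (config n)) :
  (0 <= s)%R -> (0 <= t)%R -> measurable C ->
  \int[Plaw Z eta]_(w in survival Z A s)
     grid (mesh t m) (2 ^ m) (EFin \o \1_C) (state Z s w) @[m --> \oo] -->
  Plaw Z eta (survival Z A (s + t)%R `&` state Z (s + t)%R @^-1` C).
Proof.
move=> s0 t0 mC.
have mXC := measurable_state_pre Z (s + t)%R mC.
have mal m : measurable (alive_on_grid s (mesh t m) (2 ^ m)).
  by apply: (@measurable_past _ _ _ _ Z (s + (2 ^ m)%:R * mesh t m)%R); apply: past_alive_on_grid => //; exact: mesh_ge0.
rewrite survivalD//.
have -> : survival Z A s `&` \bigcap_m alive_on_grid s (mesh t m) (2 ^ m) `&`
    state Z (s + t)%R @^-1` C = \bigcap_m (survival Z A s `&`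
     alive_on_grid s (mesh t m) (2 ^ m) `&` state Z (s + t)%R @^-1` C).
  apply/seteqP; split => w.
    by move=> [[sw aw] Cw] m _; split => //; split => //; exact: aw.
  move=> h; split; last by have [] := h 0%N I.
  by split; [have [[]] := h 0%N I|move=> m _; have [[]] := h m I].
have mF m : measurable (survival Z A s `&`
     alive_on_grid s (mesh t m) (2 ^ m) `&` state Z (s + t)%R @^-1` C).
  by apply: measurableI => //; apply: measurableI => //; exact: measurable_survival.
rewrite [X in X @ _ --> _](_ : _ = Plaw Z eta \o (fun m => survival Z A s `&`
     alive_on_grid s (mesh t m) (2 ^ m) `&` state Z (s + t)%R @^-1` C)).
  apply: nonincreasing_cvg_mu => //.
  - apply: (@le_lt_trans _ _ (Plaw Z eta setT)); last by rewrite prob_kernel ltry.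
    by apply: le_measure; rewrite ?inE.
  - exact: bigcap_measurable.
  - move=> m m' mm'; apply/subsetPset => w [[sw aw] Cw]; split => //; split => //.
    exact: alive_on_grid_nincr mm' _ aw.
apply/funext => m /=; rewrite -integral_alive_on_grid//; last 4 first.
- exact: mesh_ge0.
- exact: past_survival.
- by move=> x; rewrite lee_fin.
- by apply/measurable_EFinP; exact: measurable_indic.
rewrite meshE.
have -> : (fun w => (EFin \o \1_C) (state Z (s + t)%R w)) =
    EFin \o \1_(state Z (s + t)%R @^-1` C) :> (_ -> \bar R) by [].
rewrite integral_indic//; last first.
  by apply: measurableI => //; exact: measurable_survival.
by rewrite setIC.
Qed.

End grid.

(** * Semigroup law of the killed transitions *)

Section killed_semigroup.
Local Open Scope ereal_scope.
Context (R : realType) (n : nat) (dW : measure_display) (W : measurableType dW).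
Context (Z : cadlag_markov_process R n W) (A : local_pattern n).
Implicit Types (F G : config n -> \bar R) (eta : config n).

(* F may depend on the initial configuration in its first argument: under P_eta
   that argument can be frozen to eta. *)
Lemma ge0_integral_start eta (F : config n -> W -> \bar R) (D : set W) :
  measurable D ->
  (forall x w, 0 <= F x w) -> (forall x, measurable_fun setT (F x)) ->
  measurable_fun setT (fun w => F (state Z 0 w) w) ->
  \int[Plaw Z eta]_(w in D) F (state Z 0 w) w = \int[Plaw Z eta]_(w in D) F eta w.
Proof.
move=> mD F0 mF mF'; apply: ge0_ae_eq_integral => //.
- exact: measurable_funTS.
- exact: measurable_funTS.
- by apply: filterS (state_start Z eta) => w -> _.
Qed.

Definition killed_law t eta : {measure set (config n) -> \bar R} :=
  measure_function_pushforward__canonical__measure_function_Measure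
    (mrestr (Plaw Z eta) (measurable_survival Z A t))
    (@measurable_funPT _ _ _ _ (state Z t)).

Lemma killE t F eta : (forall x, 0 <= F x) -> measurable_fun setT F ->
  killed_transition Z A t F eta = \int[killed_law t eta]_x F x.
Proof.
move=> F0 mF; rewrite /killed_law ge0_integral_pushforward//.
rewrite ge0_integral_mrestr//; first by move=> x; exact: F0.
exact: measurable_state_comp.
Qed.

Lemma killed_lawE t eta (C : set (config n)) :
  killed_law t eta C = Plaw Z eta (survival Z A t `&` state Z t @^-1` C).
Proof. by rewrite /killed_law /pushforward /mrestr setIC. Qed.

Lemma kill_indic t eta (C : set (config n)) : measurable C ->
  killed_transition Z A t (EFin \o \1_C) eta = killed_law t eta C.
Proof.
move=> mC; rewrite killE//; last 2 first.
- by move=> x; rewrite lee_fin.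
- by apply/measurable_EFinP; exact: measurable_indic.
by rewrite integral_indic// setIT.
Qed.

Let le1_integral eta D (F : W -> \bar R) : measurable D ->
  measurable_fun setT F -> (forall x, 0 <= F x) -> (forall x, F x <= 1) ->
  \int[Plaw Z eta]_(x in D) F x <= 1.
Proof.
move=> mD mF F0 F1; apply: (@le_trans _ _ (\int[Plaw Z eta]_(x in D) cst 1 x)).
  by apply: ge0_le_integral => //; exact: measurable_funTS.
rewrite integral_cst// mul1e -(prob_kernel (s := Plaw Z) eta).
by apply: le_measure; rewrite ?inE.
Qed.

Lemma trans_le1 t F eta : measurable_fun setT F -> (forall x, 0 <= F x) ->
  (forall x, F x <= 1) -> transition Z t F eta <= 1.
Proof.
by move=> mF F0 F1; apply: (@le1_integral eta) => //; exact: measurable_state_comp.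
Qed.

(** A bound independent of the mesh, which serves as dominating function whenever the mesh tends to
    0 under an integral. *)
Lemma grid_le1 h N F eta : measurable_fun setT F -> (forall x, 0 <= F x) ->
  (forall x, F x <= 1) -> grid Z A h N F eta <= 1.
Proof.
move=> mF F0 F1.
have r1 G : (forall x, G x <= 1) -> forall x, (G \_ (~` pattern A)) x <= 1.
  by move=> G1 x; rewrite patchE; case: ifP => _; rewrite ?G1.
apply: (r1) => {eta}; elim: N => //= N IH eta; apply: trans_le1; last exact: r1.
- have mAc : measurable (~` pattern A).
    by apply: measurableC; exact: measurable_pattern.
  apply/(measurable_restrictT _ mAc).
  by apply: measurable_funTS; exact: measurable_iter_grid_step.
- by move=> x; rewrite patchE; case: ifP => // _; exact: iter_grid_step_ge0.
Qed.

Let ind_ge0 (C : set (config n)) x : 0 <= (EFin \o \1_C) x :> \bar R.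
Proof. by rewrite lee_fin. Qed.

Let ind_le1 (C : set (config n)) x : (EFin \o \1_C) x <= 1 :> \bar R.
Proof. by rewrite /= lee_fin indicE; case: (_ \in _); rewrite ?ler01. Qed.

Let ind_meas (C : set (config n)) : measurable C ->
  measurable_fun setT (EFin \o \1_C : _ -> \bar R).
Proof. by move=> mC; apply/measurable_EFinP; exact: measurable_indic. Qed.

Lemma cvg_grid eta t (C : set (config n)) : (0 <= t)%R -> measurable C ->
  grid Z A (t / (2 ^ m)%:R)%R (2 ^ m) (EFin \o \1_C) eta @[m --> \oo] -->
  killed_transition Z A t (EFin \o \1_C) eta.
Proof.
move=> t0 mC; rewrite kill_indic// killed_lawE.
have := @cvg_integral_grid _ _ _ _ Z A eta _ _ C (lexx 0%R) t0 mC; rewrite add0r.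
rewrite [X in X @ _ --> _](_ : _ = fun m =>
  grid Z A (t / (2 ^ m)%:R)%R (2 ^ m) (EFin \o \1_C) eta)//; apply/funext => m.
have mg := measurable_grid Z A (t / (2 ^ m)%:R)%R (2 ^ m) (ind_ge0 C) (ind_meas mC).
rewrite survival0 integral_mkcond.
transitivity (\int[Plaw Z eta]_w
   grid Z A (t / (2 ^ m)%:R)%R (2 ^ m) (EFin \o \1_C) (state Z 0 w)).
  apply: eq_integral => w _; rewrite patchE; case: ifPn => //.
  rewrite notin_setE /= => Aw; rewrite /grid patchE ifF//.
  by apply/negbTE; rewrite notin_setE.
rewrite (@ge0_integral_start eta (fun x _ => grid Z A (t / (2 ^ m)%:R)%R (2 ^ m) (EFin \o \1_C) x))//.
- by rewrite integral_cst// prob_kernel mule1.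
- by move=> x _; exact: grid_ge0.
- exact: measurable_state_comp.
Qed.

(** Both sides are limits of the same sequence of grid integrals: one by [cvg_integral_grid], the
    other by [cvg_grid] under the integral and dominated convergence. *)
Lemma killed_lawD eta s t (C : set (config n)) : (0 <= s)%R -> (0 <= t)%R ->
  measurable C -> killed_law (s + t)%R eta C =
  \int[Plaw Z eta]_(w in survival Z A s) killed_law t (state Z s w) C.
Proof.
move=> s0 t0 mC; rewrite killed_lawE.
have h1 := @cvg_integral_grid _ _ _ _ Z A eta _ _ C s0 t0 mC.
have mS := measurable_survival Z A s.
have mG m := measurable_grid Z A (t / (2 ^ m)%:R)%R (2 ^ m) (ind_ge0 C) (ind_meas mC).
have mK := measurable_kill Z A t (ind_ge0 C) (ind_meas mC).
have int1 : (Plaw Z eta).-integrable (survival Z A s) (cst 1).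
  apply/integrableP; split => //; under eq_integral do rewrite /= normr1.
  apply: (@le_lt_trans _ _ 1); last exact: ltry.
  exact: le1_integral.
have bnd : {ae Plaw Z eta, forall w m, survival Z A s w ->
    `|grid Z A (t / (2 ^ m)%:R)%R (2 ^ m) (EFin \o \1_C) (state Z s w)| <= cst 1 w}.
  apply: aeW => w m _; rewrite gee0_abs ?grid_ge0//.
  by apply: grid_le1 => //; exact: ind_meas.
have cvgf : {ae Plaw Z eta, forall w, survival Z A s w ->
    grid Z A (t / (2 ^ m)%:R)%R (2 ^ m) (EFin \o \1_C) (state Z s w) @[m --> \oo] -->
    killed_transition Z A t (EFin \o \1_C) (state Z s w)}.
  by apply: aeW => w _; exact: cvg_grid.
have [_ _ h2] := dominated_convergence mS
  (fun m => measurable_funTS (measurable_state_comp Z s (mG m)))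
  (measurable_funTS (measurable_state_comp Z s mK)) cvgf int1 bnd.
rewrite -(cvg_lim _ h1)// (cvg_lim _ h2)//.
by apply: eq_integral => w _; rewrite -kill_indic.
Qed.

Lemma killD eta s t F : (0 <= s)%R -> (0 <= t)%R ->
  (forall x, 0 <= F x) -> measurable_fun setT F ->
  killed_transition Z A (s + t)%R F eta = killed_transition Z A s (killed_transition Z A t F) eta.
Proof.
move=> s0 t0 F0 mF; rewrite killE//.
rewrite (@ge0_integral_mixture _ _ _ _ _ (Plaw Z eta)
  (fun w => killed_law t (state Z s w)) (survival Z A s))//=.
- by apply: eq_integral => w _; rewrite -killE.
- exact: measurable_survival.
- move=> U mU; under eq_fun do rewrite -kill_indic//.
  apply: measurable_state_comp; apply: measurable_kill; first exact: ind_ge0.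
  exact: ind_meas.
- by move=> U mU; exact: killed_lawD.
Qed.

End killed_semigroup.

(** * Time reversal *)

Section exchange.
Local Open Scope ereal_scope.
Context (R : realType) d d' (W : measurableType d) (T : measurableType d').
Context (M : {measure set W -> \bar R}) (MT : M setT < +oo) (X Y : W -> T).
Context (mX : measurable_fun setT X) (mY : measurable_fun setT Y).
Context (XY : forall B C, measurable B -> measurable C ->
  M (X @^-1` B `&` Y @^-1` C) = M (X @^-1` C `&` Y @^-1` B)).

(** The images of [M] under (X, Y) and (Y, X) are finite measures that agree on rectangles, a
    generating family stable under intersection; hence they are equal. *)
Lemma integral_exchange (F : T * T -> \bar R) : measurable_fun setT F ->
  \int[M]_w F (X w, Y w) = \int[M]_w F (Y w, X w).
Proof.
wlog F0 : F / forall x, 0 <= F x.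
  move=> h mF; rewrite integralE [RHS]integralE.
  have posE (U V : W -> T) : (fun w => F (U w, V w))^\+ = (fun w => F^\+ (U w, V w)).
    by apply/funext => w; rewrite !funeposE.
  have negE (U V : W -> T) : (fun w => F (U w, V w))^\- = (fun w => F^\- (U w, V w)).
    by apply/funext => w; rewrite !funenegE.
  rewrite !posE !negE (h F^\+) ?(h F^\-)//.
  - exact: measurable_funeneg.
  - exact: measurable_funepos.
move=> mF.
have mXY : measurable_fun setT (fun w => (X w, Y w)) by exact: measurable_fun_pair.
have mYX : measurable_fun setT (fun w => (Y w, X w)) by exact: measurable_fun_pair.
have h1 := @ge0_integral_pushforward _ _ _ _ R _ mXY M setT F measurableT mF
  (fun y _ => F0 y).
have h2 := @ge0_integral_pushforward _ _ _ _ R _ mYX M setT F measurableT mF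
  (fun y _ => F0 y).
rewrite /comp /= in h1 h2; rewrite -h1 -h2.
apply: eq_measure_integral => U mU _.
apply: (@measure_unique _ R _
  [set B `*` C | B in measurable & C in measurable] (fun=> setT)) => //.
- exact: measurable_prod_measurableType.
- move=> _ _ [B mB [C mC <-]] [B' mB' [C' mC' <-]].
  exists (B `&` B'); first exact: measurableI.
  by exists (C `&` C'); [exact: measurableI|rewrite setXI].
- by move=> _; exists setT => //; exists setT => //; rewrite setXTT.
- by rewrite bigcup_const//; exists 0%N.
- move=> _ [B mB [C mC <-]]; rewrite /pushforward.
  transitivity (M (X @^-1` B `&` Y @^-1` C)); first by [].
  by rewrite XY// setIC.
Qed.

End exchange.

(** * Symmetry of the grid operators and of the killed transitions *)

Section symmetry.
Local Open Scope ereal_scope.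
Context (R : realType) (n : nat) (dW : measure_display) (W : measurableType dW).
Context (Z : cadlag_markov_process R n W) (nu : probability (config n) R).
Implicit Types (F G : config n -> \bar R) (B C : set (config n)).

Lemma ge0_integral_init_law (F : W -> \bar R) : (forall w, 0 <= F w) ->
  measurable_fun setT F ->
  \int[init_law Z nu]_w F w = \int[nu]_eta \int[Plaw Z eta]_w F w.
Proof.
move=> F0 mF; apply: ge0_integral_mixture => // U mU.
exact: measurable_kernel.
Qed.

Lemma ge0_integral_init_lawD D (F : W -> \bar R) : measurable D ->
  (forall w, 0 <= F w) -> measurable_fun setT F ->
  \int[init_law Z nu]_(w in D) F w = \int[nu]_eta \int[Plaw Z eta]_(w in D) F w.
Proof.
move=> mD F0 mF; rewrite integral_mkcond ge0_integral_init_law//.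
- by apply: eq_integral => eta _; rewrite -integral_mkcond.
- by move=> w; rewrite patchE; case: ifP.
- by apply/(measurable_restrictT _ mD); exact: measurable_funTS.
Qed.

Lemma integral_two_times D t F G : measurable D ->
  (forall x, 0 <= F x) -> measurable_fun setT F ->
  (forall x, 0 <= G x) -> measurable_fun setT G ->
  \int[init_law Z nu]_(w in D) (F (state Z 0 w) * G (state Z t w)) =
  \int[nu]_eta (F eta * \int[Plaw Z eta]_(w in D) G (state Z t w)).
Proof.
move=> mD F0 mF G0 mG.
have mFX := measurable_state_comp Z 0%R mF.
have mGX := measurable_state_comp Z t mG.
rewrite ge0_integral_init_lawD//; last 2 first.
- by move=> w; exact: mule_ge0.
- exact: emeasurable_funM.
apply: eq_integral => eta _.
rewrite (@ge0_integral_start _ _ _ _ Z eta (fun x w => F x * G (state Z t w)))//.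
- by rewrite ge0_integralZl//; exact: measurable_funTS.
- by move=> x w; exact: mule_ge0.
- by move=> x; exact: measurable_funeM.
- exact: emeasurable_funM.
Qed.

(* The law of (eta_0, eta_t) restricted to the event D is determined by its values
   on rectangles. *)
Lemma symmetric_two_times D t F G : measurable D ->
  (forall B C, measurable B -> measurable C ->
    init_law Z nu (D `&` (state Z 0 @^-1` B `&` state Z t @^-1` C)) =
    init_law Z nu (D `&` (state Z 0 @^-1` C `&` state Z t @^-1` B))) ->
  (forall x, 0 <= F x) -> measurable_fun setT F ->
  (forall x, 0 <= G x) -> measurable_fun setT G ->
  \int[nu]_eta (F eta * \int[Plaw Z eta]_(w in D) G (state Z t w)) =
  \int[nu]_eta (G eta * \int[Plaw Z eta]_(w in D) F (state Z t w)).
Proof.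
move=> mD symD F0 mF G0 mG; rewrite -!integral_two_times//.
have mFG : measurable_fun setT (fun x : config n * config n => F x.1 * G x.2).
  by apply: emeasurable_funM; apply: measurableT_comp.
rewrite -(@ge0_integral_mrestr _ _ _ (init_law Z nu) D mD); last 2 first.
- by move=> x; exact: mule_ge0.
- by apply: emeasurable_funM; exact: measurable_state_comp.
rewrite -(@ge0_integral_mrestr _ _ _ (init_law Z nu) D mD); last 2 first.
- by move=> x; exact: mule_ge0.
- by apply: emeasurable_funM; exact: measurable_state_comp.
rewrite (@integral_exchange _ _ _ _ _ (mrestr (init_law Z nu) mD) _
  (state Z 0) (state Z t) _ _ _ (fun x => F x.1 * G x.2))//=.
- by apply: eq_integral => w _; rewrite muleC.
- rewrite /mrestr setTI (@le_lt_trans _ _ 1) ?ltry//; exact: probability_le1.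
- by move=> B C mB mC; rewrite /mrestr ![_ `&` D]setIC symD.
Qed.

Context (sym : forall t B C, (0 <= t)%R -> measurable B -> measurable C ->
    init_law Z nu (state Z 0 @^-1` B `&` state Z t @^-1` C) =
    init_law Z nu (state Z 0 @^-1` C `&` state Z t @^-1` B)).
Context (A : local_pattern n).

Lemma trans_sym t F G : (0 <= t)%R ->
  (forall x, 0 <= F x) -> measurable_fun setT F ->
  (forall x, 0 <= G x) -> measurable_fun setT G ->
  \int[nu]_eta (F eta * transition Z t G eta) = \int[nu]_eta (G eta * transition Z t F eta).
Proof.
move=> t0 F0 mF G0 mG; apply: symmetric_two_times => // B C mB mC.
by rewrite !setTI sym.
Qed.

Let restr F := F \_ (~` pattern A).

Let restrE F G x : F x * restr G x = restr F x * G x.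
Proof. by rewrite /restr !patchE; case: ifP; rewrite ?mule0 ?mul0e. Qed.

Let restr_ge0 F : (forall x, 0 <= F x) -> forall x, 0 <= restr F x.
Proof. by move=> F0 x; rewrite /restr patchE; case: ifP => _ //; exact: F0. Qed.

Let measurable_restr F : measurable_fun setT F -> measurable_fun setT (restr F).
Proof.
have mAc : measurable (~` pattern A).
  by apply: measurableC; exact: measurable_pattern.
by move=> mF; apply/(measurable_restrictT _ mAc); exact: measurable_funTS.
Qed.

(** [trans_sym] moves the outermost step from [G] to [F], and the induction hypothesis moves the
    other [N]. The moved step ends up innermost on [F], which [iterSr] accounts for. *)
Lemma grid_sym h N F G : (0 <= h)%R ->
  (forall x, 0 <= F x) -> measurable_fun setT F ->
  (forall x, 0 <= G x) -> measurable_fun setT G ->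
  \int[nu]_eta (F eta * grid Z A h N G eta) = \int[nu]_eta (G eta * grid Z A h N F eta).
Proof.
move=> h0; elim: N F G => [|N IH] F G F0 mF G0 mG.
  by apply: eq_integral => x _; rewrite /grid /= [LHS]restrE muleC.
have iG0 := iter_grid_step_ge0 Z A h N G0.
have iF0 := iter_grid_step_ge0 Z A h N F0.
have miG := measurable_iter_grid_step Z A h N G0 mG.
transitivity (\int[nu]_eta (restr F eta * transition Z h (restr (iter N (grid_step Z A h) G)) eta)).
  by apply: eq_integral => x _; rewrite /grid /= [LHS]restrE.
rewrite trans_sym//; try exact: restr_ge0; try exact: measurable_restr.
transitivity (\int[nu]_eta (grid_step Z A h F eta * grid Z A h N G eta)).
  by apply: eq_integral => x _; rewrite /grid muleC.
rewrite IH//; last 2 first.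
- exact: grid_step_ge0.
- exact: measurable_grid_step.
by rewrite /grid -iterSr.
Qed.

Let ind_ge0 C x : 0 <= (EFin \o \1_C) x :> \bar R.
Proof. by rewrite lee_fin. Qed.

Let ind_le1 C x : (EFin \o \1_C) x <= 1 :> \bar R.
Proof. by rewrite /= lee_fin indicE; case: (_ \in _); rewrite ?ler01. Qed.

Let ind_meas C : measurable C -> measurable_fun setT (EFin \o \1_C : _ -> \bar R).
Proof. by move=> mC; apply/measurable_EFinP; exact: measurable_indic. Qed.

Let cvg_int_grid t B C : (0 <= t)%R -> measurable B -> measurable C ->
  \int[nu]_eta ((\1_B eta)%:E * grid Z A (t / (2 ^ m)%:R)%R (2 ^ m) (EFin \o \1_C) eta)
    @[m --> \oo] --> \int[nu]_eta ((\1_B eta)%:E * killed_transition Z A t (EFin \o \1_C) eta).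
Proof.
move=> t0 mB mC.
have mK := measurable_kill Z A t (ind_ge0 C) (ind_meas mC).
have mG m := measurable_grid Z A (t / (2 ^ m)%:R)%R (2 ^ m) (ind_ge0 C) (ind_meas mC).
have mBG m := emeasurable_funM (ind_meas mB) (mG m).
have mBK := emeasurable_funM (ind_meas mB) mK.
have int1 : nu.-integrable setT (cst 1) by exact: finite_measure_integrable_cst.
have bnd : {ae nu, forall x m, [set: config n] x ->
    `|(\1_B x)%:E * grid Z A (t / (2 ^ m)%:R)%R (2 ^ m) (EFin \o \1_C) x| <= cst 1 x}.
  apply: aeW => x m _; rewrite gee0_abs ?mule_ge0 ?grid_ge0 ?lee_fin//.
  apply: (@le_trans _ _ (1 * 1)); last by rewrite mule1.
  apply: lee_pmul; [by rewrite lee_fin|exact: grid_ge0|exact: ind_le1|].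
  by apply: grid_le1 => //; exact: ind_meas.
have cvgf : {ae nu, forall x, [set: config n] x ->
    (\1_B x)%:E * grid Z A (t / (2 ^ m)%:R)%R (2 ^ m) (EFin \o \1_C) x @[m --> \oo] -->
    (\1_B x)%:E * killed_transition Z A t (EFin \o \1_C) x}.
  by apply: aeW => w _; apply: cvgeZl => //; exact: cvg_grid.
by have [_ _] := dominated_convergence measurableT mBG mBK cvgf int1 bnd.
Qed.

(** For indicators this is the limit of [grid_sym] as the mesh tends to 0; [symmetric_two_times]
    then extends it from rectangles to functions. *)
Lemma kill_sym t F G : (0 <= t)%R ->
  (forall x, 0 <= F x) -> measurable_fun setT F ->
  (forall x, 0 <= G x) -> measurable_fun setT G ->
  \int[nu]_eta (F eta * killed_transition Z A t G eta) = \int[nu]_eta (G eta * killed_transition Z A t F eta).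
Proof.
move=> t0 F0 mF G0 mG; apply: symmetric_two_times => //.
  exact: measurable_survival.
have symE B C : measurable B -> measurable C ->
    init_law Z nu (survival Z A t `&` (state Z 0 @^-1` B `&` state Z t @^-1` C)) =
    \int[nu]_eta ((\1_B eta)%:E * killed_transition Z A t (EFin \o \1_C) eta).
  move=> mB mC; rewrite -integral_two_times//; last 3 first.
  - exact: measurable_survival.
  - exact: ind_meas.
  - exact: ind_meas.
  have -> : (fun w => (\1_B (state Z 0 w))%:E * (EFin \o \1_C) (state Z t w)) =
      EFin \o \1_(state Z 0 @^-1` B `&` state Z t @^-1` C) :> (_ -> \bar R).
    apply/funext => w /=; rewrite -EFinM indicI/=; congr (_ * _)%:E.
  rewrite integral_indic//; first by rewrite setIC.
  - exact: measurable_survival.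
  - by apply: measurableI; exact: measurable_state_pre.
move=> B C mB mC; rewrite (symE B C mB mC) (symE C B mC mB).
have hBC := cvg_int_grid t0 mB mC.
have hCB := cvg_int_grid t0 mC mB.
have gridE : (fun m => \int[nu]_eta ((\1_B eta)%:E *
      grid Z A (t / (2 ^ m)%:R)%R (2 ^ m) (EFin \o \1_C) eta)) =
    (fun m => \int[nu]_eta ((\1_C eta)%:E *
      grid Z A (t / (2 ^ m)%:R)%R (2 ^ m) (EFin \o \1_B) eta)).
  apply/funext => m; have h0 : (0 <= t / (2 ^ m)%:R)%R by rewrite divr_ge0.
  exact: (grid_sym _ h0 (ind_ge0 B) (ind_meas mB) (ind_ge0 C) (ind_meas mC)).
by rewrite gridE in hBC; exact: (cvg_unique _ hBC hCB).
Qed.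

End symmetry.

(** * The space L^2(nu) *)

Section L2_space.
Context (R : realType) d (T : measurableType d) (nu : probability T R).
Implicit Types f g h : T -> R.
Local Notation L2 := (Lfun nu 2%:E).

Let le12 : (1 <= 2%:E :> \bar R)%E.
Proof. by rewrite lee_fin ler1n. Qed.

Lemma L2_measurable f : f \in L2 -> measurable_fun setT f.
Proof. by rewrite inE => /andP[/[!inE]]. Qed.

Lemma L2norm_sqr f : (L2norm nu f `^ 2 = \int[nu]_x ((f x) ^+ 2)%:E)%E.
Proof.
rewrite /L2norm poweR_Lnorm//; apply: eq_integral => x _ /=.
by rewrite powR_mulrn// -normrX ger0_norm// sqr_ge0.
Qed.

Lemma L2P f : measurable_fun setT f -> (\int[nu]_x ((f x) ^+ 2)%:E < +oo)%E ->
  f \in L2.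
Proof.
move=> mf f2; rewrite inE; apply/andP; split; first by rewrite inE.
rewrite inE /= /finite_norm ltey; apply/eqP => fy.
by move: f2; rewrite -L2norm_sqr /L2norm fy poweRyr ?ltxx.
Qed.

Lemma L2D f g : f \in L2 -> g \in L2 -> (fun x => f x + g x) \in L2.
Proof. by move=> f2 g2; have [_ /(_ f g f2 g2)] := Lfun_addr_closed nu le12. Qed.

Lemma L2Z (c : R) f : f \in L2 -> (fun x => c * f x) \in L2.
Proof.
move=> f2; rewrite (_ : (fun x => c * f x) = c \o* f).
  by apply: Lfun_scale => //; rewrite ler1n.
by apply/funext => x /=; rewrite mulrC.
Qed.

Lemma L2B f g : f \in L2 -> g \in L2 -> (fun x => f x - g x) \in L2.
Proof.
move=> f2 g2; have := L2D f2 (L2Z (-1) g2).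
by under eq_fun do rewrite mulN1r.
Qed.

Lemma L2_cst (c : R) : cst c \in L2.
Proof. exact: Lfun_cst. Qed.

Lemma L2_mul_integrable f g : f \in L2 -> g \in L2 ->
  nu.-integrable setT (EFin \o (fun x => f x * g x)).
Proof. by move=> f2 g2; apply/Lfun1_integrable; exact: Lfun2_mul_Lfun1. Qed.

Lemma L2_le f g : measurable_fun setT f -> g \in L2 ->
  (forall x, `|f x| <= `|g x|) -> f \in L2.
Proof.
move=> mf g2 fg; apply: L2P => //.
have /integrableP[_] := L2_mul_integrable g2 g2; apply: le_lt_trans.
apply: ge0_le_integral => //.
- by move=> x _; rewrite lee_fin sqr_ge0.
- by apply/measurable_EFinP; exact: measurable_funX.
- apply: measurableT_comp => //; apply/measurable_EFinP.
  by apply: measurable_funM; exact: L2_measurable.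
- move=> x _; rewrite abse_EFin lee_fin -[f x ^+ 2]ger0_norm ?sqr_ge0//.
  by rewrite normrX normrM -expr2 lerXn2r ?nnegrE.
Qed.

Lemma L2dotC f g : L2dot nu f g = L2dot nu g f.
Proof. by apply: eq_Rintegral => x _; rewrite mulrC. Qed.

Lemma L2dotDl f g h : f \in L2 -> g \in L2 -> h \in L2 ->
  L2dot nu (fun x => f x + g x) h = L2dot nu f h + L2dot nu g h.
Proof.
move=> f2 g2 h2; rewrite /L2dot -RintegralD//; try exact: L2_mul_integrable.
by apply: eq_Rintegral => x _; rewrite mulrDl.
Qed.

Lemma L2dotZl (c : R) f h : f \in L2 -> h \in L2 ->
  L2dot nu (fun x => c * f x) h = c * L2dot nu f h.
Proof.
move=> f2 h2; rewrite /L2dot -RintegralZl//; last exact: L2_mul_integrable.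
by apply: eq_Rintegral => x _; rewrite mulrA.
Qed.

Lemma L2dotBl f g h : f \in L2 -> g \in L2 -> h \in L2 ->
  L2dot nu (fun x => f x - g x) h = L2dot nu f h - L2dot nu g h.
Proof.
move=> f2 g2 h2; rewrite /L2dot -RintegralB//; try exact: L2_mul_integrable.
by apply: eq_Rintegral => x _; rewrite mulrBl.
Qed.

Lemma L2dotZr (c : R) f h : f \in L2 -> h \in L2 ->
  L2dot nu h (fun x => c * f x) = c * L2dot nu h f.
Proof. by move=> f2 h2; rewrite L2dotC L2dotZl// L2dotC. Qed.

Lemma L2dotDr f g h : f \in L2 -> g \in L2 -> h \in L2 ->
  L2dot nu h (fun x => f x + g x) = L2dot nu h f + L2dot nu h g.
Proof. by move=> f2 g2 h2; rewrite L2dotC L2dotDl// L2dotC (L2dotC g). Qed.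

Lemma L2dotBr f g h : f \in L2 -> g \in L2 -> h \in L2 ->
  L2dot nu h (fun x => f x - g x) = L2dot nu h f - L2dot nu h g.
Proof. by move=> f2 g2 h2; rewrite L2dotC L2dotBl// L2dotC (L2dotC g). Qed.

Lemma L2dot_ae f f' g : measurable_fun setT f -> measurable_fun setT f' ->
  measurable_fun setT g -> {ae nu, forall x, f x = f' x} ->
  L2dot nu f g = L2dot nu f' g.
Proof.
move=> mf mf' mg ff'; congr fine; apply: ae_eq_integral => //.
- by apply/measurable_EFinP; exact: measurable_funM.
- by apply/measurable_EFinP; exact: measurable_funM.
- by apply: filterS ff' => x -> _.
Qed.

Lemma L2dot_ge0 f : 0 <= L2dot nu f f.
Proof. by apply: Rintegral_ge0 => x _; rewrite -expr2 sqr_ge0. Qed.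

Lemma L2dot_EFin f g : f \in L2 -> g \in L2 ->
  ((L2dot nu f g)%:E = \int[nu]_x (f x * g x)%:E)%E.
Proof.
move=> f2 g2; rewrite /L2dot /Rintegral fineK//.
by apply: integrable_fin_num => //; exact: L2_mul_integrable.
Qed.

(** Real-valued, so that norm estimates are real arithmetic; on L^2 it is the value of [L2norm], by
    [L2norm_EFin]. *)
Definition L2nrm f : R := Num.sqrt (L2dot nu f f).

Lemma L2nrm_ge0 f : 0 <= L2nrm f. Proof. exact: sqrtr_ge0. Qed.

Lemma L2nrm_sqr f : L2nrm f ^+ 2 = L2dot nu f f.
Proof. by rewrite /L2nrm sqr_sqrtr// L2dot_ge0. Qed.

Lemma L2norm_EFin f : f \in L2 -> L2norm nu f = (L2nrm f)%:E.
Proof.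
move=> f2.
have fin : L2norm nu f \is a fin_num.
  rewrite ge0_fin_numE ?Lnorm_ge0//.
  by move: f2; rewrite inE => /andP[_]; rewrite inE.
have := L2norm_sqr f; rewrite -(fineK fin) poweR_EFin.
under eq_integral do rewrite expr2.
rewrite -L2dot_EFin// => -[].
have n0 : 0 <= fine (L2norm nu f) by rewrite fine_ge0// Lnorm_ge0.
rewrite powR_mulrn// => nE; congr EFin.
by rewrite /L2nrm -nE sqrtr_sqr ger0_norm.
Qed.

(** The quadratic |f - t g|^2 in [t] is nonnegative at its minimizer [b / c]. *)
Lemma L2_CS_sqr f g : f \in L2 -> g \in L2 ->
  L2dot nu f g ^+ 2 <= L2dot nu f f * L2dot nu g g.
Proof.
move=> f2 g2.
set a := L2dot nu f f; set b := L2dot nu f g; set c := L2dot nu g g.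
have q t : 0 <= a - 2 * t * b + t ^+ 2 * c.
  have := L2dot_ge0 (fun x => f x - t * g x).
  have tg2 := L2Z t g2; have ftg2 := L2B f2 tg2.
  rewrite L2dotBl ?L2dotBr ?L2dotZl ?L2dotZr//.
  rewrite (L2dotC g) -/a -/b -/c; congr (_ <= _); ring.
have c0 : 0 <= c by exact: L2dot_ge0.
move: c0; rewrite le_eqVlt => /orP[/eqP c0|c0].
  have [b0|b0] := eqVneq b 0; first by rewrite b0 expr0n/= mulr_ge0// L2dot_ge0.
  (* For [c = 0] the quadratic is affine; if [b] were nonzero, it would take the value -1 at this
     point. *)
  have := q ((a + 1) / (2 * b)); rewrite -c0 mulr0 addr0.
  have -> : a - 2 * ((a + 1) / (2 * b)) * b = -1 by field.
  by rewrite ler0N1.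
have := q (b / c).
have -> : a - 2 * (b / c) * b + (b / c) ^+ 2 * c = a - b ^+ 2 / c.
  by field; rewrite gt_eqF.
by rewrite subr_ge0 ler_pdivrMr.
Qed.

Lemma L2_CS f g : f \in L2 -> g \in L2 -> `|L2dot nu f g| <= L2nrm f * L2nrm g.
Proof.
move=> f2 g2; rewrite -(@ler_pXn2r _ 2)// ?nnegrE ?mulr_ge0 ?L2nrm_ge0//.
by rewrite exprMn !L2nrm_sqr -normrX ger0_norm ?sqr_ge0// L2_CS_sqr.
Qed.

Lemma L2nrmZ (c : R) f : f \in L2 -> L2nrm (fun x => c * f x) = `|c| * L2nrm f.
Proof.
move=> f2; rewrite /L2nrm L2dotZl ?L2dotZr//; last exact: L2Z.
by rewrite mulrA -expr2 sqrtrM ?sqr_ge0// sqrtr_sqr.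
Qed.

Lemma L2nrm_triangle f g : f \in L2 -> g \in L2 ->
  L2nrm (fun x => f x + g x) <= L2nrm f + L2nrm g.
Proof.
move=> f2 g2; rewrite -(@ler_pXn2r _ 2)// ?nnegrE ?addr_ge0 ?L2nrm_ge0//.
rewrite L2nrm_sqr L2dotDl ?L2dotDr//; last exact: L2D.
have := le_trans (ler_norm _) (L2_CS f2 g2).
rewrite -!L2nrm_sqr sqrrD (L2dotC g f) !L2nrm_sqr -mulr_natl => h; lra.
Qed.

Lemma L2nrm_triangleB f g h : f \in L2 -> g \in L2 -> h \in L2 ->
  L2nrm (fun x => f x - h x) <= L2nrm (fun x => f x - g x) + L2nrm (fun x => g x - h x).
Proof.
move=> f2 g2 h2; rewrite [X in L2nrm X <= _](_ : _ = fun x => (f x - g x) + (g x - h x)).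
  by apply: L2nrm_triangle; exact: L2B.
by apply/funext => x; rewrite addrA subrK.
Qed.

Lemma L2nrmBC f g : L2nrm (fun x => f x - g x) = L2nrm (fun x => g x - f x).
Proof.
by rewrite /L2nrm; congr Num.sqrt; apply: eq_Rintegral => x _; rewrite -mulrNN !opprB.
Qed.

Lemma L2nrm_eq0 f : f \in L2 -> L2nrm f = 0 -> {ae nu, forall x, f x = 0}.
Proof.
move=> f2 nf0; have : L2dot nu f f = 0 by rewrite -L2nrm_sqr nf0 expr0n.
move=> ff0; have f0 : (\int[nu]_x (f x * f x)%:E = 0)%E by rewrite -L2dot_EFin// ff0.
have mf := L2_measurable f2.
have mff : measurable_fun setT (fun x => (f x * f x)%:E).
  by apply/measurable_EFinP; exact: measurable_funM.
have [h _] := ae_eq_integral_abs nu measurableT mff.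
apply: filterS (h _) => [x /(_ I) /eqP|].
  by rewrite /= eqe mulf_eq0 orbb => /eqP.
rewrite -f0; apply: eq_integral => x _.
by rewrite abse_EFin ger0_norm// -expr2 sqr_ge0.
Qed.

Lemma L2nrm_ae f g : measurable_fun setT f -> measurable_fun setT g ->
  {ae nu, forall x, f x = g x} -> L2nrm f = L2nrm g.
Proof.
move=> mf mg fg; rewrite /L2nrm (L2dot_ae mf mg)// L2dotC (L2dot_ae mf mg)//.
Qed.

(** This is the passage from nonnegative functions to all of L^2 in every linear identity below. *)
Lemma L2_posneg f : f \in L2 -> exists p q, [/\ p \in L2, q \in L2,
  forall x, 0 <= p x, forall x, 0 <= q x & f = fun x => p x - q x].
Proof.
move=> f2; exists f^\+, f^\-; split => //.
- apply: (L2_le _ f2); first by apply: measurable_funrpos; exact: L2_measurable f2.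
  move=> x; rewrite ger0_norm ?funrpos_ge0// /funrpos.
  by rewrite ge_max ler_norm normr_ge0.
- apply: (L2_le _ f2); first by apply: measurable_funrneg; exact: L2_measurable f2.
  move=> x; rewrite ger0_norm ?funrneg_ge0// /funrneg.
  by rewrite ge_max normr_ge0 andbT -normrN ler_norm.
- by rewrite -[LHS]funrposBneg.
Qed.

End L2_space.

(** * Completeness of L^2(nu) along geometrically fast Cauchy sequences *)

Section completeness.
Context (R : realType) d (T : measurableType d) (nu : probability T R).
Local Notation L2 := (Lfun nu 2%:E).
Context (f : nat -> T -> R) (f2 : forall k, f k \in L2).
Let eps (k : nat) : R := ((2 ^ k)%:R)^-1.
Context (cauchy_f : forall k, L2nrm nu (fun x => f k.+1 x - f k x) <= eps k).

Let mf k : measurable_fun setT (f k). Proof. exact: L2_measurable. Qed.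

Let g k x := `|f k.+1 x - f k x|.

Let mg k : measurable_fun setT (fun x => (g k x)%:E).
Proof.
by apply/measurable_EFinP; apply: measurableT_comp => //; exact: measurable_funB.
Qed.

Let int_g k : (\int[nu]_x (g k x)%:E <= (eps k)%:E)%E.
Proof.
have d2 := L2B (f2 k.+1) (f2 k).
have g2 : g k \in L2.
  apply: (L2_le _ d2) => [|x]; last by rewrite /g normr_id.
  by apply: measurableT_comp => //; exact: measurable_funB.
have one2 := L2_cst nu 1.
have -> : (\int[nu]_x (g k x)%:E = (L2dot nu (g k) (cst 1))%:E)%E.
  by rewrite L2dot_EFin//; apply: eq_integral => x _; rewrite mulr1.
rewrite lee_fin (le_trans (ler_norm _))// (le_trans (L2_CS g2 one2))//.
have -> : L2nrm nu (cst 1) = 1.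
  rewrite /L2nrm /L2dot; under eq_Rintegral do rewrite mulr1.
  rewrite Rintegral_cst// mul1r (_ : fine _ = 1) ?sqrtr1//.
  by rewrite -[RHS]/(fine 1%E); congr fine; exact: probability_setT.
rewrite mulr1 (le_trans _ (cauchy_f k))// /L2nrm ler_sqrt ?L2dot_ge0//.
rewrite le_eqVlt; apply/orP; left; apply/eqP.
by apply: eq_Rintegral => x _; rewrite /g -normrM ger0_norm// -expr2 sqr_ge0.
Qed.

Let ae_summable : {ae nu, forall x, (\sum_(0 <= k <oo) (g k x)%:E < +oo)%E}.
Proof.
have g0 k x : (0 <= (g k x)%:E)%E by rewrite lee_fin normr_ge0.
have mS : measurable_fun setT (fun x => \sum_(0 <= k <oo) (g k x)%:E)%E.
  exact: ge0_emeasurable_sum.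
have : nu.-integrable setT (fun x => \sum_(0 <= k <oo) (g k x)%:E)%E.
  apply/integrableP; split => //.
  under eq_integral do rewrite gee0_abs ?nneseries_ge0//.
  rewrite integral_nneseries//.
  (* [eps k] written as 2 / 2^(k + 1), to match the geometric series of
     [cvg_geometric_eseries_half]. *)
  apply: (@le_lt_trans _ _ (\sum_(0 <= k <oo) (2 / (2 ^ (k + 1))%:R)%:E)%E).
    apply: lee_nneseries => k _; first by move=> _; exact: integral_ge0.
    apply: (le_trans (int_g k)); rewrite lee_fin /eps addn1 expnS natrM.
    rewrite invfM mulrA divff ?mul1r// pnatr_eq0//.
  by rewrite (cvg_lim _ (@cvg_geometric_eseries_half R 2 0))// ltry.
move=> /(integrable_ae measurableT); apply: filterS => x /(_ I).
by rewrite ge0_fin_numE ?nneseries_ge0.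
Qed.

Let ae_cvg : {ae nu, forall x, cvgn (f ^~ x)}.
Proof.
apply: filterS ae_summable => x sx.
have g0 k : (0 <= (g k x)%:E)%E by rewrite lee_fin normr_ge0.
have scvg : cvgn (series (telescope (f ^~ x))).
  apply: normed_cvg; apply: nondecreasing_is_cvgn.
    move=> m n mn; rewrite /series /=.
    by rewrite [leRHS](big_cat_nat _ mn)//= lerDl sumr_ge0.
  exists (fine (\sum_(0 <= k <oo) (g k x)%:E)%E) => _ [m _ <-].
  rewrite -lee_fin fineK; last by rewrite ge0_fin_numE ?nneseries_ge0.
  rewrite /series /= -sumEFin.
  exact: (nneseries_lim_ge m (fun k _ _ => g0 k)).
have -> : f ^~ x = (fun m => f 0%N x + series (telescope (f ^~ x)) m).
  by apply/funext => m; rewrite (eq_sum_telescope (f ^~ x) m).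
by apply: is_cvgD => //; exact: is_cvg_cst.
Qed.

(** The bound is the exact sum of [eps i] for [k <= i < j], so that the induction closes. *)
Let nrm_fB k j : (k <= j)%N ->
  L2nrm nu (fun x => f j x - f k x) <= 2 * eps k - 2 * eps j.
Proof.
elim: j => [|j IH].
  rewrite leqn0 => /eqP ->; rewrite subrr.
  rewrite /L2nrm /L2dot; under eq_Rintegral do rewrite subrr mulr0.
  by rewrite Rintegral_cst// mul0r sqrtr0.
rewrite leq_eqVlt => /orP[/eqP <-|].
  rewrite subrr /L2nrm /L2dot; under eq_Rintegral do rewrite subrr mulr0.
  by rewrite Rintegral_cst// mul0r sqrtr0.
rewrite ltnS => kj; apply: (le_trans (L2nrm_triangleB (f2 j.+1) (f2 j) (f2 k))).
have epsS : eps j = 2 * eps j.+1.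
  by rewrite /eps expnS natrM invfM mulrA divff ?mul1r// pnatr_eq0.
have := cauchy_f j; have := IH kj; rewrite epsS => h1 h2; lra.
Qed.

(** The increments are summable in L^1, hence almost everywhere, which yields a pointwise limit;
    Fatou's lemma passes [nrm_fB] to the limit in [j]. *)
Lemma L2_fast_cauchy_cvg : exists2 F, F \in L2 &
  forall k, L2nrm nu (fun x => f k x - F x) <= 2 * eps k.
Proof.
have [N [mN N0 hN]] := ae_cvg.
have mNC : measurable (~` N) by exact: measurableC.
(* Set to 0 on the exceptional null set, the sequence converges everywhere and its limit is
   measurable. *)
pose h k := f k \_ (~` N).
have mh k : measurable_fun setT (h k).
  by apply/(measurable_restrictT _ mNC); exact: measurable_funTS.
pose F x := limn (h ^~ x).
have hF x : h ^~ x @ \oo --> F x.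
  rewrite /F; have [Nx|Nx] := boolP (x \in N).
    have -> : h ^~ x = fun=> 0.
      by apply/funext => k; rewrite /h patchE ifF// in_setC Nx.
    exact: is_cvg_cst.
  have -> : h ^~ x = f ^~ x.
    by apply/funext => k; rewrite /h patchE in_setC Nx.
  by apply: contrapT => fx; move/negP: Nx; apply; rewrite inE; exact: hN.
have mF : measurable_fun setT F by apply: measurable_fun_cvg (fun x _ => hF x).
have aef k : {ae nu, forall x, h k x = f k x}.
  exists N; split => // x /= hx; apply: contrapT => Nx; apply: hx.
  by rewrite /h patchE ifT// inE.
have bound k : (\int[nu]_x ((f k x - F x) ^+ 2)%:E <= ((2 * eps k) ^+ 2)%:E)%E.
  have mkj j : measurable_fun setT (fun x => ((h k x - h j x) ^+ 2)%:E).
    by apply/measurable_EFinP; apply: measurable_funX; exact: measurable_funB.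
  have -> : (\int[nu]_x ((f k x - F x) ^+ 2)%:E = \int[nu]_x ((h k x - F x) ^+ 2)%:E)%E.
    apply: ge0_ae_eq_integral => //.
    - by apply/measurable_EFinP; apply: measurable_funX; exact: measurable_funB.
    - by apply/measurable_EFinP; apply: measurable_funX; exact: measurable_funB.
    - by move=> x _; rewrite lee_fin sqr_ge0.
    - by move=> x _; rewrite lee_fin sqr_ge0.
    - by apply: filterS (aef k) => x ->.
  have cvgkj x : ((h k x - h j x) ^+ 2)%:E @[j --> \oo] --> ((h k x - F x) ^+ 2)%:E.
    apply: cvg_EFin; first exact: nearW.
    rewrite /comp /=; under eq_fun do rewrite expr2; rewrite expr2.
    by apply: cvgM; apply: cvgB => //; exact: cvg_cst.
  have -> : (\int[nu]_x ((h k x - F x) ^+ 2)%:E =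
      \int[nu]_x limn_einf (fun j => ((h k x - h j x) ^+ 2)%:E))%E.
    by apply: eq_integral => x _; rewrite (cvg_limn_einf_sup (cvgkj x)).1.
  apply: (le_trans (fatou _ _ mkj _)) => //.
    by move=> j x _; rewrite lee_fin sqr_ge0.
  rewrite limn_einf_lim; apply: lime_le; first exact: is_cvg_einfs.
  (* [j >= m] puts the term in the tail infimum, and [j >= k] allows [nrm_fB]. *)
  apply: nearW => m; pose j := maxn k m.
  apply: (@le_trans _ _ (\int[nu]_x ((h k x - h j x) ^+ 2)%:E)%E).
    by apply: ereal_inf_lbound; exists j => //=; exact: leq_maxr.
  have -> : (\int[nu]_x ((h k x - h j x) ^+ 2)%:E =
      \int[nu]_x ((f j x - f k x) ^+ 2)%:E)%E.
    apply: ge0_ae_eq_integral => //.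
    - by apply/measurable_EFinP; apply: measurable_funX; exact: measurable_funB.
    - by move=> x _; rewrite lee_fin sqr_ge0.
    - by move=> x _; rewrite lee_fin sqr_ge0.
    - apply: filterS2 (aef k) (aef j) => x -> -> _.
      by rewrite -sqrrN opprB.
  under eq_integral do rewrite expr2.
  rewrite -L2dot_EFin; try exact: L2B.
  rewrite lee_fin -L2nrm_sqr lerXn2r ?nnegrE ?L2nrm_ge0//.
    by rewrite mulr_ge0// invr_ge0.
  apply: (le_trans (nrm_fB (leq_maxl k m))).
  by rewrite gerBl mulr_ge0// invr_ge0.
have fF2 k : (fun x => f k x - F x) \in L2.
  apply: L2P; first exact: measurable_funB.
  by rewrite (le_lt_trans (bound k))// ltry.
exists F.
  rewrite (_ : F = fun x => f 0%N x - (f 0%N x - F x)); first exact: L2B.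
  by apply/funext => x; rewrite opprB addrC subrK.
move=> k; rewrite -(@ler_pXn2r _ 2)// ?nnegrE ?L2nrm_ge0//; last first.
  by rewrite mulr_ge0// invr_ge0.
rewrite L2nrm_sqr -lee_fin L2dot_EFin//; apply: le_trans (bound k).
by under [leRHS]eq_integral do rewrite expr2.
Qed.

End completeness.

(** * The killed semigroup on L^2(nu) *)

Section jensen.
Context (R : realType) d (W : measurableType d) (m : {measure set W -> \bar R}).
Context (D : set W) (mD : measurable D) (mD1 : (m D <= 1)%E).
Context (g : W -> R) (mg : measurable_fun setT g).
Context (g2 : (\int[m]_(w in D) ((g w) ^+ 2)%:E < +oo)%E).

Let mDg : measurable_fun D g. Proof. exact: measurable_funTS. Qed.

Let int_cst (c : R) : m.-integrable D (EFin \o cst c).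
Proof.
apply/integrableP; split; first exact/measurable_EFinP.
under eq_integral do rewrite /=.
by rewrite integral_cst// lte_mul_pinfty// (le_lt_trans mD1)// ltry.
Qed.

Let int_sqr : m.-integrable D (EFin \o (fun w => g w ^+ 2)).
Proof.
apply/integrableP; split.
  by apply/measurable_EFinP; exact: measurable_funX.
by under eq_integral do rewrite /= ger0_norm ?sqr_ge0//.
Qed.

Lemma integrable_sqr : m.-integrable D (EFin \o g).
Proof.
apply: (@le_integrable _ _ _ _ _ _ _ (EFin \o (fun w => 1 + g w ^+ 2))) => //.
- exact/measurable_EFinP.
- move=> w _; rewrite !abse_EFin lee_fin [leRHS]ger0_norm ?addr_ge0 ?sqr_ge0//.
  have [?|?] := ger0P (g w); nra.
- have := integrableD mD (int_cst 1) int_sqr.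
  by apply: eq_integrable => // w _.
Qed.

(** Integrate [2 J g - J^2 <= g^2]: as [D] has mass at most 1, the left-hand side integrates to at
    least [J^2]. *)
Lemma sqr_Rintegral_le :
  (((\int[m]_(w in D) g w) ^+ 2)%:E <= \int[m]_(w in D) ((g w) ^+ 2)%:E)%E.
Proof.
have intg := integrable_sqr.
set J := \int[m]_(w in D) g w.
have -> : (\int[m]_(w in D) ((g w) ^+ 2)%:E = (\int[m]_(w in D) (g w ^+ 2))%:E)%E.
  by rewrite /Rintegral fineK//; exact: integrable_fin_num.
have intJg : m.-integrable D (EFin \o (fun w => 2 * J * g w)).
  have := integrableZl mD (2 * J) intg.
  by apply: eq_integrable => // w _ /=; rewrite EFinM.
rewrite lee_fin; apply: (@le_trans _ _ (\int[m]_(w in D) (2 * J * g w - J ^+ 2))).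
  rewrite RintegralB//; last exact: (int_cst (J ^+ 2)).
  rewrite RintegralZl// Rintegral_cst// -/J.
  have : fine (m D) <= 1.
    by rewrite -lee_fin fineK// ge0_fin_numE// (le_lt_trans mD1)// ltry.
  have := sqr_ge0 J; nra.
apply: le_Rintegral => //.
- have := integrableB mD intJg (int_cst (J ^+ 2)).
  by apply: eq_integrable => // w _ /=; rewrite EFinB.
- by move=> w _; have := sqr_ge0 (g w - J); nra.
Qed.

End jensen.

(** * Contraction, linearity, semigroup law and symmetry on L^2(nu) *)

Section killed_L2.
Context (R : realType) (n : nat) (dW : measure_display) (W : measurableType dW).
Context (Z : cadlag_markov_process R n W) (nu : probability (config n) R).
Context (nu_invariant : invariant_measure Z nu) (A : local_pattern n).
Implicit Types (f g : config n -> R) (F G : config n -> \bar R).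
Local Notation L2 := (Lfun nu 2%:E).
Local Notation Kr := (killed_semigroup Z A).

Lemma integral_trans t F : 0 <= t -> (forall x, (0 <= F x)%E) ->
  measurable_fun setT F ->
  (\int[nu]_eta transition Z t F eta = \int[nu]_eta F eta)%E.
Proof.
move=> t0 F0 mF.
rewrite -(ge0_integral_init_law Z nu (fun w => F0 (state Z t w))); last first.
  exact: measurable_state_comp.
have mX : measurable_fun setT (state Z t) by exact: measurable_funPT.
have h := @ge0_integral_pushforward _ _ _ _ R _ mX (init_law Z nu) setT F
  measurableT mF (fun y _ => F0 y).
rewrite /comp in h; rewrite -[LHS]h.
by apply: eq_measure_integral => U mU _; exact: nu_invariant.
Qed.

Lemma kill_le_trans t F eta : (forall x, (0 <= F x)%E) ->
  measurable_fun setT F -> (killed_transition Z A t F eta <= transition Z t F eta)%E.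
Proof.
move=> F0 mF; apply: ge0_subset_integral => //; first exact: measurable_survival.
exact: measurable_state_comp.
Qed.

Lemma integral_kill_le t F : 0 <= t -> (forall x, (0 <= F x)%E) ->
  measurable_fun setT F ->
  (\int[nu]_eta killed_transition Z A t F eta <= \int[nu]_eta F eta)%E.
Proof.
move=> t0 F0 mF; rewrite -(integral_trans t0 F0 mF).
apply: ge0_le_integral => //.
- by move=> x _; exact: kill_ge0.
- exact: measurable_kill.
- exact: measurable_trans.
- by move=> x _; exact: kill_le_trans.
Qed.

(** By invariance, for almost every [eta] the process started at [eta] is almost surely outside the
    given null set at time [t]. *)
Lemma kill_ae t F G : 0 <= t -> (forall x, (0 <= F x)%E) -> measurable_fun setT F ->
  (forall x, (0 <= G x)%E) -> measurable_fun setT G ->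
  {ae nu, forall x, F x = G x} ->
  {ae nu, forall x, killed_transition Z A t F x = killed_transition Z A t G x}.
Proof.
move=> t0 F0 mF G0 mG [N [mN N0 hN]].
have ind0 x : (0 <= (EFin \o \1_N) x :> \bar R)%E by rewrite lee_fin.
have indm : measurable_fun setT (EFin \o \1_N : config n -> \bar R).
  by apply/measurable_EFinP; exact: measurable_indic.
have mT := measurable_trans Z t ind0 indm.
have T0 : (\int[nu]_x `|transition Z t (EFin \o \1_N) x| = 0)%E.
  under eq_integral do rewrite gee0_abs ?trans_ge0//.
  by rewrite integral_trans// integral_indic// setIT; exact: N0.
have [h _] := ae_eq_integral_abs nu measurableT mT.
apply: filterS (h T0) => eta /(_ I) /= etaN.
have mS := measurable_survival Z A t.
apply: ge0_ae_eq_integral => //.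
- by apply: measurable_funTS; exact: measurable_state_comp.
- by apply: measurable_funTS; exact: measurable_state_comp.
exists (state Z t @^-1` N); split.
- exact: measurable_state_pre.
- rewrite -etaN /transition -[RHS]/(integral _ _ (EFin \o \1_(state Z t @^-1` N))).
  by rewrite integral_indic ?setIT//; exact: measurable_state_pre.
- by move=> w /= FG; apply: hN => /= FG'; apply: FG.
Qed.

Let sq f : config n -> \bar R := fun x => ((f x) ^+ 2)%:E.

Let sq_ge0 f x : (0 <= sq f x)%E. Proof. by rewrite lee_fin sqr_ge0. Qed.

Let measurable_sq f : measurable_fun setT f -> measurable_fun setT (sq f).
Proof. by move=> mf; apply/measurable_EFinP; exact: measurable_funX. Qed.

Let measurable_state f t : measurable_fun setT f ->
  measurable_fun setT (fun w => f (state Z t w)).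
Proof. by move=> mf; exact: measurableT_comp. Qed.

Let surv1 t eta : (Plaw Z eta (survival Z A t) <= 1)%E.
Proof.
rewrite -(prob_kernel (s := Plaw Z) eta); apply: le_measure; rewrite ?inE//.
exact: measurable_survival.
Qed.

(** The exceptional set matters: on it the integral defining [Kr t f] may diverge and take a default
    value, so linearity and the semigroup law are stated almost everywhere. *)
Lemma ae_kill_sqr_fin f t : 0 <= t -> f \in L2 ->
  {ae nu, forall eta, (killed_transition Z A t (sq f) eta < +oo)%E}.
Proof.
move=> t0 f2; have mf := L2_measurable f2.
have : nu.-integrable setT (killed_transition Z A t (sq f)).
  apply/integrableP; split; first by apply: measurable_kill => //; exact: measurable_sq.
  under eq_integral do rewrite gee0_abs ?kill_ge0//.
  apply: (le_lt_trans (integral_kill_le t0 (sq_ge0 f) (measurable_sq mf))).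
  have /integrableP[_] := Lfun2_integrable_sqr f2.
  by under eq_integral do rewrite /= ger0_norm ?sqr_ge0//.
move=> /(integrable_ae measurableT); apply: filterS => x /(_ I).
by rewrite ge0_fin_numE// kill_ge0.
Qed.

Lemma ae_integrable_killed f t : 0 <= t -> f \in L2 ->
  {ae nu, forall eta, (Plaw Z eta).-integrable (survival Z A t)
     (EFin \o (fun w => f (state Z t w)))}.
Proof.
move=> t0 f2; apply: filterS (ae_kill_sqr_fin t0 f2) => eta h.
apply: integrable_sqr => //; first exact: measurable_survival.
by apply: measurable_state; exact: L2_measurable f2.
Qed.

Lemma measurable_Kr f t : measurable_fun setT f -> measurable_fun setT (Kr t f).
Proof.
move=> mf; have mF : measurable_fun setT (EFin \o f) by exact/measurable_EFinP.
have -> : Kr t f = (fun eta => fine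
    (killed_transition Z A t (EFin \o f)^\+ eta - killed_transition Z A t (EFin \o f)^\- eta)%E).
  apply/funext => eta; rewrite /killed_semigroup /Rintegral integralE.
  congr (fine (_ - _)%E); apply: eq_integral => w _.
    by rewrite !funeposE.
  by rewrite !funenegE.
apply: measurableT_comp => //; apply: emeasurable_funB.
  by apply: measurable_kill => //; exact: measurable_funepos.
by apply: measurable_kill => //; exact: measurable_funeneg.
Qed.

(* Jensen's inequality for the sub-probability P_eta(., tau > t), and invariance. *)
Lemma Kr_sqr_le f t : 0 <= t -> f \in L2 ->
  (\int[nu]_x ((Kr t f x) ^+ 2)%:E <= \int[nu]_x ((f x) ^+ 2)%:E)%E.
Proof.
move=> t0 f2; have mf := L2_measurable f2.
apply: le_trans (integral_kill_le t0 (sq_ge0 f) (measurable_sq mf)).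
apply: ae_ge0_le_integral => //.
- by move=> x _; rewrite lee_fin sqr_ge0.
- by apply/measurable_EFinP; apply: measurable_funX; exact: measurable_Kr.
- by move=> x _; exact: kill_ge0.
- by apply: measurable_kill => //; exact: measurable_sq.
- apply: filterS (ae_kill_sqr_fin t0 f2) => eta h _.
  apply: sqr_Rintegral_le => //; first exact: measurable_survival.
  exact: measurable_state.
Qed.

Lemma Kr_L2 f t : 0 <= t -> f \in L2 -> Kr t f \in L2.
Proof.
move=> t0 f2; apply: L2P; first by apply: measurable_Kr; exact: L2_measurable f2.
apply: (le_lt_trans (Kr_sqr_le t0 f2)).
have /integrableP[_] := Lfun2_integrable_sqr f2.
by under eq_integral do rewrite /= ger0_norm ?sqr_ge0//.
Qed.

Lemma Kr_contraction f t : 0 <= t -> f \in L2 -> L2nrm nu (Kr t f) <= L2nrm nu f.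
Proof.
move=> t0 f2; rewrite /L2nrm ler_sqrt ?L2dot_ge0// -lee_fin.
rewrite !L2dot_EFin//; try exact: Kr_L2.
have := Kr_sqr_le t0 f2; under eq_integral do rewrite expr2.
by under [X in (_ <= X)%E]eq_integral do rewrite expr2.
Qed.

Lemma KrB f g t : 0 <= t -> f \in L2 -> g \in L2 ->
  {ae nu, forall x, Kr t (fun x => f x - g x) x = Kr t f x - Kr t g x}.
Proof.
move=> t0 f2 g2.
apply: filterS2 (ae_integrable_killed t0 f2) (ae_integrable_killed t0 g2).
by move=> eta hf hg; apply: RintegralB => //; exact: measurable_survival.
Qed.

Lemma KrZ (c : R) f t : 0 <= t -> f \in L2 ->
  {ae nu, forall x, Kr t (fun x => c * f x) x = c * Kr t f x}.
Proof.
move=> t0 f2; apply: filterS (ae_integrable_killed t0 f2) => eta hf.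
by apply: RintegralZl => //; exact: measurable_survival.
Qed.

(** The contraction property applied to [f - g], whose norm is 0. *)
Lemma Kr_ae f g t : 0 <= t -> f \in L2 -> g \in L2 ->
  {ae nu, forall x, f x = g x} -> {ae nu, forall x, Kr t f x = Kr t g x}.
Proof.
move=> t0 f2 g2 fg; have d2 := L2B f2 g2.
have d0 : L2nrm nu (fun x => f x - g x) = 0.
  rewrite (@L2nrm_ae _ _ _ _ _ (cst 0)).
  - by rewrite /L2nrm /L2dot; under eq_Rintegral do rewrite mulr0;
      rewrite Rintegral_cst// mul0r sqrtr0.
  - exact: (L2_measurable d2).
  - exact: measurable_cst.
  - by apply: filterS fg => x ->; rewrite subrr.
have Kd0 : L2nrm nu (Kr t (fun x => f x - g x)) = 0.
  by apply/eqP; rewrite eq_le L2nrm_ge0 -d0 Kr_contraction.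
apply: filterS2 (KrB t0 f2 g2) (L2nrm_eq0 (Kr_L2 t0 d2) Kd0) => x -> /eqP.
by rewrite subr_eq0 => /eqP.
Qed.

Lemma Kr_killE f t : 0 <= t -> f \in L2 -> (forall x, 0 <= f x) ->
  {ae nu, forall x, killed_transition Z A t (EFin \o f) x = (Kr t f x)%:E}.
Proof.
move=> t0 f2 f0; apply: filterS (ae_integrable_killed t0 f2) => eta hf.
rewrite /killed_semigroup /Rintegral fineK//; apply: integrable_fin_num => //.
exact: measurable_survival.
Qed.

Let KrD_time_ge0 f s t : 0 <= s -> 0 <= t -> f \in L2 -> (forall x, 0 <= f x) ->
  {ae nu, forall x, Kr (s + t) f x = Kr s (Kr t f) x}.
Proof.
move=> s0 t0 f2 f0; have st0 := addr_ge0 s0 t0.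
have Kf2 := Kr_L2 t0 f2.
have Kf0 x : 0 <= Kr t f x by exact: Rintegral_ge0.
have mf := L2_measurable f2.
have F0 x : (0 <= (EFin \o f) x)%E by rewrite lee_fin.
have mF : measurable_fun setT (EFin \o f) by exact/measurable_EFinP.
have KF0 x : (0 <= (EFin \o Kr t f) x)%E by rewrite lee_fin.
have mKF : measurable_fun setT (EFin \o Kr t f).
  by apply/measurable_EFinP; exact: measurable_Kr.
have h := kill_ae s0 (fun x => kill_ge0 Z A t x F0) (measurable_kill Z A t F0 mF)
   KF0 mKF (Kr_killE t0 f2 f0).
apply: filterS3 (Kr_killE st0 f2 f0) (Kr_killE s0 Kf2 Kf0) h => x h1 h2 h3.
by apply: EFin_inj; rewrite -h1 -h2 -h3 killD.
Qed.

Lemma Kr_semigroup f s t : 0 <= s -> 0 <= t -> f \in L2 ->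
  {ae nu, forall x, Kr (s + t) f x = Kr s (Kr t f) x}.
Proof.
move=> s0 t0 f2; have st0 := addr_ge0 s0 t0.
have [p [q [p2 q2 p0 q0 ->]]] := L2_posneg f2.
have Kp2 := Kr_L2 t0 p2; have Kq2 := Kr_L2 t0 q2.
have h1 := KrB st0 p2 q2.
have h2 := Kr_ae s0 (Kr_L2 t0 (L2B p2 q2)) (L2B Kp2 Kq2) (KrB t0 p2 q2).
have h3 := KrB s0 Kp2 Kq2.
have h4 := KrD_time_ge0 s0 t0 p2 p0.
have h5 := KrD_time_ge0 s0 t0 q2 q0.
apply: filterS3 h1 h2 (filterI h3 (filterI h4 h5)) => x -> -> [-> [-> ->]].
by [].
Qed.

Context (sym : forall t (B C : set (config n)), 0 <= t -> measurable B -> measurable C ->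
    init_law Z nu (state Z 0 @^-1` B `&` state Z t @^-1` C) =
    init_law Z nu (state Z 0 @^-1` C `&` state Z t @^-1` B)).

Lemma Kr_sym f g t : 0 <= t -> f \in L2 -> g \in L2 ->
  L2dot nu f (Kr t g) = L2dot nu (Kr t f) g.
Proof.
move=> t0.
have ge0_case p q : p \in L2 -> q \in L2 -> (forall x, 0 <= p x) ->
    (forall x, 0 <= q x) -> L2dot nu p (Kr t q) = L2dot nu (Kr t p) q.
  move=> p2 q2 p0 q0; rewrite [RHS]L2dotC; congr fine.
  have mP : measurable_fun setT (EFin \o p) by apply/measurable_EFinP; exact: L2_measurable p2.
  have mQ : measurable_fun setT (EFin \o q) by apply/measurable_EFinP; exact: L2_measurable q2.
  have kE h k : h \in L2 -> k \in L2 -> (forall x, 0 <= h x) ->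
      (forall x, 0 <= k x) -> (\int[nu]_x (h x * Kr t k x)%:E =
      \int[nu]_x ((EFin \o h) x * killed_transition Z A t (EFin \o k) x))%E.
    move=> h2 k2 h0 k0.
    have mh := L2_measurable h2; have mk := L2_measurable k2.
    apply: ge0_ae_eq_integral => //.
    - by apply/measurable_EFinP; apply: measurable_funM => //; exact: measurable_Kr.
    - apply: emeasurable_funM; first exact/measurable_EFinP.
      by apply: measurable_kill => [x|]; [rewrite lee_fin|exact/measurable_EFinP].
    - by move=> x _; rewrite lee_fin mulr_ge0//; exact: Rintegral_ge0.
    - move=> x _; apply: mule_ge0; first by rewrite lee_fin.
      by apply: kill_ge0 => y; rewrite lee_fin.
    - by apply: filterS (Kr_killE t0 k2 k0) => x -> _; rewrite EFinM.
  rewrite (kE p q p2 q2 p0 q0) (kE q p q2 p2 q0 p0).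
  by apply: (kill_sym sym A t0) => // x; rewrite lee_fin.
have half p g' : p \in L2 -> (forall x, 0 <= p x) -> g' \in L2 ->
    L2dot nu p (Kr t g') = L2dot nu (Kr t p) g'.
  move=> p2 p0 g2.
  have [a [b [a2 b2 a0 b0 ->]]] := L2_posneg g2.
  have Ka2 := Kr_L2 t0 a2; have Kb2 := Kr_L2 t0 b2; have Kp2 := Kr_L2 t0 p2.
  have ab2 := L2B a2 b2.
  rewrite L2dotBr// -!ge0_case// -L2dotBr// [LHS]L2dotC [RHS]L2dotC.
  apply: L2dot_ae (KrB t0 a2 b2).
  - by apply: measurable_Kr; exact: L2_measurable ab2.
  - exact: L2_measurable (L2B Ka2 Kb2).
  - exact: L2_measurable p2.
move=> f2 g2; have [a [b [a2 b2 a0 b0 ->]]] := L2_posneg f2.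
have Ka2 := Kr_L2 t0 a2; have Kb2 := Kr_L2 t0 b2; have Kg2 := Kr_L2 t0 g2.
have ab2 := L2B a2 b2.
rewrite L2dotBl// !half// -L2dotBl//; apply/esym/L2dot_ae; last exact: KrB.
- by apply: measurable_Kr; exact: L2_measurable ab2.
- exact: L2_measurable (L2B Ka2 Kb2).
- exact: L2_measurable g2.
Qed.

End killed_L2.

(** * Reversibility from the self-adjoint generator *)

Section time_zero.
Context (R : realType) (n : nat) (dW : measure_display) (W : measurableType dW).
Context (Z : cadlag_markov_process R n W) (A : local_pattern n).

Lemma killed_semigroup0 (f : config n -> R) : measurable_fun setT f ->
  forall eta, killed_semigroup Z A 0 f eta = f eta * \1_(~` pattern A) eta.
Proof.
move=> mf eta.
have mAc : measurable (~` pattern A).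
  by apply: measurableC; exact: measurable_pattern.
rewrite /killed_semigroup /Rintegral survival0 integral_mkcond.
rewrite -[RHS]/(fine (f eta * \1_(~` pattern A) eta)%:E); congr fine.
transitivity (\int[Plaw Z eta]_w (f eta * \1_(~` pattern A) eta)%:E)%E; last first.
  by rewrite integral_cst// prob_kernel mule1.
have mX : measurable_fun setT (fun w => (f (state Z 0 w) * \1_(~` pattern A) (state Z 0 w))%:E).
  apply/measurable_EFinP; apply: measurable_funM; first exact: measurableT_comp.
  by apply: measurableT_comp => //; exact: measurable_indic.
transitivity (\int[Plaw Z eta]_w (f (state Z 0 w) * \1_(~` pattern A) (state Z 0 w))%:E)%E.
  apply: eq_integral => w _; rewrite patchE indicE.
  rewrite (_ : (w \in _) = (state Z 0 w \in ~` pattern A)); last by [].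
  by case: ifP => _; rewrite ?mulr1 ?mulr0.
apply: ae_eq_integral => //.
by apply: filterS (state_start Z eta) => w -> _.
Qed.

End time_zero.

Section no_pattern.
Context (n : nat).

Let no_pattern_local : exists S : seq 'rV[int]_n, forall eta xi : config n,
  {in S, eta =1 xi} -> (set0 : set (config n)) eta <-> (set0 : set (config n)) xi.
Proof. by exists [::]. Qed.

(* Killing at the empty pattern never happens, so that the results on the killed
   semigroup also apply to the semigroup itself. *)
Definition no_pattern : local_pattern n := LocalPattern no_pattern_local.

End no_pattern.

Section reversibility.
Context (R : realType) (n : nat) (dW : measure_display) (W : measurableType dW).
Context (Z : cadlag_markov_process R n W) (nu : probability (config n) R).
Context (nu_invariant : invariant_measure Z nu).
Context (generator_self_adjoint : L2_self_adjoint nu (generator Z nu)).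
Implicit Types (f g h k l : config n -> R).
Local Notation L2 := (Lfun nu 2%:E).
Local Notation S := (killed_semigroup Z (no_pattern n)).

Lemma survival_no_pattern t : survival Z (no_pattern n) t = setT.
Proof. by apply/seteqP; split => // w _; apply/survivalP => s _ _ []. Qed.

Lemma semigroup_no_pattern t f : semigroup Z t f = S t f.
Proof. by apply/funext => eta; rewrite /killed_semigroup survival_no_pattern. Qed.

Lemma no_pattern0 f : measurable_fun setT f -> S 0 f = f.
Proof.
move=> mf; apply/funext => eta; rewrite killed_semigroup0//= setC0.
by rewrite indicT mulr1.
Qed.

(** The error of the difference quotient when [k] is the generator applied to [f]. *)
Let quot t f k : config n -> R := fun x => t^-1 * (S t f x - f x) - k x.

Let quot_L2 t f k : 0 < t -> f \in L2 -> k \in L2 -> quot t f k \in L2.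
Proof.
move=> t0 f2 k2; apply: L2B => //; apply: L2Z; apply: L2B => //.
by apply: Kr_L2 => //; exact: ltW.
Qed.

Lemma generator_quot f k : generator Z nu f k -> forall e, 0 < e ->
  exists2 dl, 0 < dl & forall t, 0 < t -> t < dl -> L2nrm nu (quot t f k) < e.
Proof.
move=> [f2 k2 fk] e e0.
have /fine_cvgP[_ /cvgr0Pnorm_lt /(_ e e0)] := fk.
rewrite /at_right near_withinE /= => -[dl /= dl0 h].
exists dl => // t t0 tdl.
have := h t; rewrite /= sub0r normrN gtr0_norm// => /(_ tdl t0).
rewrite semigroup_no_pattern (_ : (fun eta => _) = quot t f k).
  by rewrite L2norm_EFin/= ?ger0_norm ?L2nrm_ge0//; exact: quot_L2.
by apply/funext => x; rewrite /quot mulrC.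
Qed.

(** [S s] commutes with [S t], so the error for [S s f] is almost everywhere [S s] applied to the
    error for [f], and [S s] contracts. *)
Lemma quot_semigroup_le s t f k : 0 <= s -> 0 < t -> f \in L2 -> k \in L2 ->
  L2nrm nu (quot t (S s f) (S s k)) <= L2nrm nu (quot t f k).
Proof.
move=> s0 t0 f2 k2; have t0' := ltW t0.
have q2 := quot_L2 t0 f2 k2.
have Sf2 := Kr_L2 nu_invariant (no_pattern n) s0 f2.
have Sk2 := Kr_L2 nu_invariant (no_pattern n) s0 k2.
have Stf2 := Kr_L2 nu_invariant (no_pattern n) t0' f2.
apply: le_trans (Kr_contraction nu_invariant (no_pattern n) s0 q2).
rewrite le_eqVlt; apply/orP; left; apply/eqP.
have Stff2 := L2B Stf2 f2.
apply: L2nrm_ae.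
- exact: L2_measurable (quot_L2 t0 Sf2 Sk2).
- by apply: measurable_Kr; exact: L2_measurable q2.
have h1 := KrB nu_invariant (no_pattern n) s0 (L2Z t^-1 Stff2) k2.
have h2 := KrZ nu_invariant (no_pattern n) t^-1 s0 Stff2.
have h3 := KrB nu_invariant (no_pattern n) s0 Stf2 f2.
have h4 := Kr_semigroup nu_invariant (no_pattern n) s0 t0' f2.
have h5 := Kr_semigroup nu_invariant (no_pattern n) t0' s0 f2.
apply: filterS2 (filterI h1 h2) (filterI h3 (filterI h4 h5)) => x.
move=> [e1 e2] [e3 [e4 e5]].
by rewrite /quot e1 e2 e3 -e4 -e5 (addrC s t).
Qed.

Lemma generator_semigroup s f k : 0 <= s -> generator Z nu f k ->
  generator Z nu (S s f) (S s k).
Proof.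
move=> s0 gfk; have [f2 k2 _] := gfk.
have Sf2 := Kr_L2 nu_invariant (no_pattern n) s0 f2.
have Sk2 := Kr_L2 nu_invariant (no_pattern n) s0 k2.
split => //; apply/fine_cvgP; split.
  near=> t; have t0 : 0 < t by near: t; exact: nbhs_right_gt.
  rewrite semigroup_no_pattern (_ : (fun eta => _) = quot t (S s f) (S s k)).
    by rewrite L2norm_EFin//; exact: quot_L2.
  by apply/funext => x; rewrite /quot mulrC.
apply/cvgr0Pnorm_lt => e e0; have [dl dl0 h] := generator_quot gfk e0.
near=> t; have t0 : 0 < t by near: t; exact: nbhs_right_gt.
have tdl : t < dl by near: t; exact: nbhs_right_lt.
rewrite /= semigroup_no_pattern (_ : (fun eta => _) = quot t (S s f) (S s k)).
  rewrite L2norm_EFin/=; last exact: quot_L2.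
  rewrite ger0_norm ?L2nrm_ge0// (le_lt_trans _ (h t t0 tdl))//.
  exact: quot_semigroup_le.
by apply/funext => x; rewrite /quot mulrC.
Unshelve. all: by end_near. Qed.

Let gen_sym f k g l : generator Z nu f k -> generator Z nu g l ->
  L2dot nu k g = L2dot nu f l.
Proof.
move=> fk gl; have [_ g2] := generator_self_adjoint; have [gL2 lL2 _] := gl.
by have [_ /(_ gl) h] := g2 g l gL2 lL2; exact: h.
Qed.

(* By symmetry of the generator only the errors of the difference quotients
   contribute; they shrink with t uniformly in s and r, since the semigroup
   contracts. Summing over N steps of size t / N then needs no differentiability
   of s |-> S_s f. *)
Lemma step_sym f k g l e t s r : generator Z nu f k -> generator Z nu g l ->
  0 <= s -> 0 <= r -> 0 < t ->
  L2nrm nu (quot t f k) <= e -> L2nrm nu (quot t g l) <= e ->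
  `|L2dot nu (S t (S s f)) (S r g) - L2dot nu (S s f) (S t (S r g))| <=
  t * (e * (L2nrm nu f + L2nrm nu g)).
Proof.
move=> fk gl s0 r0 t0 qf qg; have [f2 k2 _] := fk; have [g2 l2 _] := gl.
have gen_a := generator_semigroup s0 fk; have gen_b := generator_semigroup r0 gl.
have [a2 la2 _] := gen_a; have [b2 lb2 _] := gen_b.
have qa := le_trans (quot_semigroup_le s0 t0 f2 k2) qf.
have qb := le_trans (quot_semigroup_le r0 t0 g2 l2) qg.
have na := Kr_contraction nu_invariant (no_pattern n) s0 f2.
have nb := Kr_contraction nu_invariant (no_pattern n) r0 g2.
have ab := gen_sym gen_a gen_b.
move: a2 la2 b2 lb2 qa qb na nb ab.
move: (S s f) (S s k) (S r g) (S r l) => a la b lb a2 la2 b2 lb2 qa qb na nb ab.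
have qa2 := quot_L2 t0 a2 la2; have qb2 := quot_L2 t0 b2 lb2.
(* First-order expansion with exact remainder: the generator terms cancel by [ab], and only the
   errors survive. *)
have stE c lc : S t c = fun x => c x + t * (lc x + quot t c lc x).
  apply/funext => x; rewrite /quot; field; rewrite gt_eqF//.
rewrite (stE a la) (stE b lb).
have ea := L2D la2 qa2; have eb := L2D lb2 qb2.
rewrite L2dotDl ?L2dotDr ?L2dotZl ?L2dotZr//; try exact: L2Z.
rewrite L2dotDl// L2dotDr// ab.
rewrite (_ : _ - _ = t * (L2dot nu (quot t a la) b - L2dot nu a (quot t b lb))); last by ring.
rewrite normrM (gtr0_norm t0) ler_pM2l// (le_trans (ler_normB _ _))//.
rewrite mulrDr addrC; apply: lerD.
  rewrite (le_trans (L2_CS a2 qb2))// mulrC ler_pM ?L2nrm_ge0//.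
by rewrite (le_trans (L2_CS qa2 b2))// ler_pM ?L2nrm_ge0.
Qed.

Let telescope_le (phi : nat -> R) N dl :
  (forall j, (j < N)%N -> `|phi j - phi j.+1| <= dl) ->
  `|phi 0%N - phi N| <= N%:R * dl.
Proof.
elim: N => [_|N IH h]; first by rewrite subrr normr0 mul0r.
rewrite -natr1 mulrDl mul1r -(subrKA (phi N)).
apply: (le_trans (ler_normD _ _)); apply: lerD; last exact: h.
by apply: IH => j jN; apply: h; exact: leqW.
Qed.

(** [phi j] below is <S_(t - j h) f, S_(j h) g>; it joins the two sides in [N] steps, each
    controlled by [step_sym]. *)
Lemma semigroup_sym_generator f k g l t : generator Z nu f k ->
  generator Z nu g l -> 0 < t -> L2dot nu (S t f) g = L2dot nu f (S t g).
Proof.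
move=> fk gl t0; have [f2 k2 _] := fk; have [g2 l2 _] := gl.
set C := L2nrm nu f + L2nrm nu g.
have C0 : 0 <= C by rewrite addr_ge0 ?L2nrm_ge0.
(* The [N] errors of size [h e C] add up to [t e C] whatever [N] is, so [e] can tend to 0. *)
suff est e : 0 < e -> `|L2dot nu (S t f) g - L2dot nu f (S t g)| <= t * (e * C).
  apply/eqP; rewrite -subr_eq0 -normr_le0; apply/ler_addgt0Pr => e e0.
  have tC0 : 0 < t * (C + 1) by rewrite mulr_gt0// ltr_wpDl.
  rewrite add0r (le_trans (est (e / (t * (C + 1))) _))// ?divr_gt0//.
  rewrite -[leRHS](mulfVK (lt0r_neq0 tC0)) (_ : t * _ = e / (t * (C + 1)) * (t * C)).
    by rewrite ler_wpM2l// ?divr_ge0 ?(ltW tC0) ?(ltW e0)// ler_pM2l// lerDl.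
  ring.
move=> e0.
have [d1 d10 h1] := generator_quot fk e0; have [d2 d20 h2] := generator_quot gl e0.
(* Chosen so that [h = t / N] is below both thresholds [d1] and [d2]. *)
pose N := (Num.truncn (t / Num.min d1 d2)).+1.
have N0 : (0 : R) < N%:R by rewrite ltr0n.
have m0 : 0 < Num.min d1 d2 by rewrite lt_min d10.
pose h := t / N%:R.
have h0 : 0 < h by rewrite divr_gt0.
have hm : h < Num.min d1 d2.
  by rewrite /h ltr_pdivrMr// mulrC -ltr_pdivrMr// truncnS_gt.
have /andP[hd1 hd2] : (h < d1) && (h < d2) by rewrite -lt_min.
have q1 := ltW (h1 h h0 hd1); have q2 := ltW (h2 h h0 hd2).
pose phi j := L2dot nu (S ((N - j)%:R * h) f) (S (j%:R * h) g).
have step j : (j < N)%N -> `|phi j - phi j.+1| <= h * (e * C).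
  move=> jN; pose s := (N - j.+1)%:R * h; pose r := j%:R * h.
  have s0 : 0 <= s by rewrite mulr_ge0// ltW.
  have r0 : 0 <= r by rewrite mulr_ge0// ltW.
  have mS x c : 0 <= x -> c \in L2 -> measurable_fun setT (S x c).
    by move=> x0 c2; apply: measurable_Kr; exact: L2_measurable c2.
  have h0' := ltW h0.
  have Sf2 := Kr_L2 nu_invariant (no_pattern n) s0 f2.
  have Sg2 := Kr_L2 nu_invariant (no_pattern n) r0 g2.
  have -> : phi j = L2dot nu (S h (S s f)) (S r g).
    have sh : (N - j)%:R * h = h + s.
      by rewrite /s -(subnSK jN) -natr1 mulrDl mul1r addrC.
    apply: L2dot_ae; first by apply: mS => //; rewrite mulr_ge0.
    - exact: mS.
    - exact: mS.
    - by rewrite sh; exact: Kr_semigroup.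
  have -> : phi j.+1 = L2dot nu (S s f) (S h (S r g)).
    have rh : j.+1%:R * h = h + r by rewrite /r -natr1 mulrDl mul1r addrC.
    rewrite /phi L2dotC [RHS]L2dotC; apply: L2dot_ae.
    - by apply: mS => //; rewrite mulr_ge0.
    - exact: mS.
    - exact: mS.
    - by rewrite rh; exact: Kr_semigroup.
  exact: (step_sym fk gl s0 r0 h0 q1 q2).
have := telescope_le step.
have -> : N%:R * (h * (e * C)) = t * (e * C).
  by rewrite mulrA; congr (_ * _); rewrite /h mulrC divfK// gt_eqF.
have Nh : N%:R * h = t by rewrite /h mulrC divfK// gt_eqF.
rewrite /phi subn0 subnn mul0r Nh !no_pattern0//.
- exact: L2_measurable f2.
- exact: L2_measurable g2.
Qed.

(** Replacing [f] by a close element of the domain changes each side by at most |f - f'| |g|, by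
    contraction. *)
Let sym_dense g t : 0 <= t -> g \in L2 ->
  (forall f k, generator Z nu f k -> L2dot nu (S t f) g = L2dot nu f (S t g)) ->
  forall f, f \in L2 -> L2dot nu (S t f) g = L2dot nu f (S t g).
Proof.
move=> t0 g2 H f f2; have [dense _] := generator_self_adjoint.
have Sg2 := Kr_L2 nu_invariant (no_pattern n) t0 g2.
have Sf2 := Kr_L2 nu_invariant (no_pattern n) t0 f2.
apply/eqP; rewrite -subr_eq0 -normr_le0; apply/ler_addgt0Pr => e e0; rewrite add0r.
set C := 2 * L2nrm nu g + 1.
have C0 : 0 < C by rewrite ltr_wpDl// mulr_ge0// L2nrm_ge0.
have [f' [k [f'k]]] := dense f f2 (e / C) (divr_gt0 e0 C0).
have [f'2 _ _] := f'k; have d2 := L2B f2 f'2.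
have Sf'2 := Kr_L2 nu_invariant (no_pattern n) t0 f'2.
have Sd2 := Kr_L2 nu_invariant (no_pattern n) t0 d2.
rewrite (_ : (f \- f')%R = fun x => f x - f' x)// L2norm_EFin// lte_fin => dlt.
have -> : L2dot nu (S t f) g - L2dot nu f (S t g) =
    L2dot nu (S t (fun x => f x - f' x)) g - L2dot nu (fun x => f x - f' x) (S t g).
  have -> : L2dot nu (S t (fun x => f x - f' x)) g =
      L2dot nu (fun x => S t f x - S t f' x) g.
    apply: L2dot_ae.
    - exact: L2_measurable Sd2.
    - exact: L2_measurable (L2B Sf2 Sf'2).
    - exact: L2_measurable g2.
    - exact: KrB.
  rewrite !L2dotBl// (H _ _ f'k); ring.
rewrite (le_trans (ler_normB _ _))//.
have h1 : `|L2dot nu (S t (fun x => f x - f' x)) g| <= e / C * L2nrm nu g.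
  rewrite (le_trans (L2_CS Sd2 g2))// ler_wpM2r ?L2nrm_ge0//.
  by rewrite (le_trans (Kr_contraction nu_invariant _ t0 d2))// ltW.
have h2 : `|L2dot nu (fun x => f x - f' x) (S t g)| <= e / C * L2nrm nu g.
  rewrite (le_trans (L2_CS d2 Sg2))// ler_pM ?L2nrm_ge0//; first exact: ltW.
  exact: Kr_contraction.
apply: (le_trans (lerD h1 h2)); rewrite -[leRHS](mulfVK (lt0r_neq0 C0)).
by rewrite -mulrDr ler_wpM2l ?divr_ge0 ?(ltW e0) ?(ltW C0)// /C mulr_natl mulr2n lerDl.
Qed.

Lemma semigroup_sym f g t : 0 <= t -> f \in L2 -> g \in L2 ->
  L2dot nu (S t f) g = L2dot nu f (S t g).
Proof.
rewrite le_eqVlt => /orP[/eqP <- f2 g2|t0 f2 g2].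
  by rewrite !no_pattern0//; [exact: L2_measurable g2|exact: L2_measurable f2].
apply: (sym_dense (ltW t0) g2 _ f2) => {f2}f k fk; have [f2 _ _] := fk.
rewrite L2dotC [RHS]L2dotC; apply/esym.
apply: (sym_dense (ltW t0) f2 _ g2) => {g2}g l gl.
by rewrite L2dotC [RHS]L2dotC; apply/esym; exact: semigroup_sym_generator fk gl t0.
Qed.

(** The probability of the rectangle given by [B] and [C] is the scalar product of [\1_B] and
    [S t \1_C]. *)
Lemma reversible t (B C : set (config n)) : 0 <= t -> measurable B -> measurable C ->
  init_law Z nu (state Z 0 @^-1` B `&` state Z t @^-1` C) =
  init_law Z nu (state Z 0 @^-1` C `&` state Z t @^-1` B).
Proof.
move=> t0.
have ind2 (D : set (config n)) : measurable D -> \1_D \in L2.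
  move=> mD; apply: (L2_le _ (L2_cst nu 1)) => [|x]; first exact: measurable_indic.
  by rewrite /= normr1 ger0_norm// indicE; case: (_ \in _).
have E (B' C' : set (config n)) : measurable B' -> measurable C' ->
    init_law Z nu (state Z 0 @^-1` B' `&` state Z t @^-1` C') =
    (L2dot nu \1_B' (S t \1_C'))%:E.
  move=> mB mC; have mBX := measurable_state_pre Z 0 mB.
  have mCX := measurable_state_pre Z t mC.
  have iB : measurable_fun setT (EFin \o \1_B' : config n -> \bar R).
    by apply/measurable_EFinP; exact: measurable_indic.
  have iC : measurable_fun setT (EFin \o \1_C' : config n -> \bar R).
    by apply/measurable_EFinP; exact: measurable_indic.
  have iC0 x : (0 <= (EFin \o \1_C') x :> \bar R)%E by rewrite lee_fin.
  have iB0 x : (0 <= (EFin \o \1_B') x :> \bar R)%E by rewrite lee_fin.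
  have SC2 := Kr_L2 nu_invariant (no_pattern n) t0 (ind2 _ mC).
  rewrite L2dot_EFin//; last exact: ind2.
  transitivity (\int[init_law Z nu]_w ((EFin \o \1_B') (state Z 0 w) *
      (EFin \o \1_C') (state Z t w)))%E.
    rewrite -[LHS](_ : \int[init_law Z nu]_w
        (\1_(state Z 0 @^-1` B' `&` state Z t @^-1` C') w)%:E = _)%E; last first.
      by rewrite integral_indic ?setIT//; exact: measurableI.
    by apply: eq_integral => w _; rewrite indicI.
  rewrite integral_two_times//.
  apply: ge0_ae_eq_integral => //.
  - apply: emeasurable_funM => //.
    have := measurable_kill Z (no_pattern n) t iC0 iC.
    by rewrite /killed_transition survival_no_pattern.
  - apply/measurable_EFinP; apply: measurable_funM; first exact: measurable_indic.
    exact: L2_measurable SC2.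
  - by move=> x _; apply: mule_ge0 => //; exact: integral_ge0.
  - by move=> x _; rewrite lee_fin mulr_ge0// Rintegral_ge0.
  - apply: filterS (Kr_killE nu_invariant (no_pattern n) t0 (ind2 _ mC) _) => [x|x//].
    by rewrite EFinM /killed_transition survival_no_pattern => <-.
move=> mB mC; rewrite (E B C mB mC) (E C B mC mB); congr EFin.
by rewrite -(semigroup_sym t0 (ind2 B mB) (ind2 C mC)) L2dotC.
Qed.

End reversibility.

(** * Densities and conditional laws *)

Section density.
Local Open Scope charge_scope.
Context (R : realType) d (T : measurableType d) (nu m : probability T R).
Context (mnu : m `<< nu).

Lemma measurable_density : measurable_fun setT (density nu m).
Proof. by apply: measurableT_comp => //; apply: measurable_int; exact: Radon_Nikodym_integrable. Qed.

(** [density] is built on the derivative of charges, while the change of variables concerns the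
    derivative for sigma-finite measures. *)
Let densityE : {ae nu, forall x,
  Radon_Nikodym_SigmaFinite.f m nu x = (density nu m x)%:E}.
Proof.
apply: filterS (ae_eq_Radon_Nikodym_SigmaFinite mnu measurableT) => x /(_ I) ->.
by rewrite fineK//; exact: Radon_Nikodym_fin_num.
Qed.

Lemma density_ge0 : {ae nu, forall x, 0 <= density nu m x}.
Proof.
apply: filterS densityE => x h; rewrite -lee_fin -h.
exact: Radon_Nikodym_SigmaFinite.f_ge0.
Qed.

Lemma ge0_integral_density (F : T -> \bar R) : (forall x, (0 <= F x)%E) ->
  measurable_fun setT F ->
  (\int[m]_x F x = \int[nu]_x (F x * (density nu m x)%:E))%E.
Proof.
move=> F0 mF; rewrite -(Radon_Nikodym_SigmaFinite.change_of_variables mnu)//.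
apply: ae_eq_integral => //.
- apply: emeasurable_funM => //; apply: measurable_int.
  exact: Radon_Nikodym_SigmaFinite.f_integrable.
- apply: emeasurable_funM => //; apply/measurable_EFinP.
  exact: measurable_density.
- by apply: filterS densityE => x -> _.
Qed.

End density.

(** * Integrals against a measure with a weight in L^2(nu) *)

Section weighted.
Context (R : realType) d (T : measurableType d) (nu m : probability T R).
Context (h : T -> R) (h2 : h \in Lfun nu 2%:E).
Context (mh : forall F : T -> \bar R, (forall x, (0 <= F x)%E) ->
  measurable_fun setT F -> (\int[m]_x F x = \int[nu]_x (F x * (h x)%:E))%E).
Local Notation L2 := (Lfun nu 2%:E).

Let weighted_ge0 p : p \in L2 -> (forall x, 0 <= p x) ->
  (\int[m]_x (p x)%:E = (L2dot nu p h)%:E)%E.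
Proof.
move=> p2 p0; rewrite mh//; last by apply/measurable_EFinP; exact: L2_measurable p2.
by rewrite L2dot_EFin//.
Qed.

Let weighted_integrable p : p \in L2 -> (forall x, 0 <= p x) ->
  m.-integrable setT (EFin \o p).
Proof.
move=> p2 p0; apply/integrableP; split.
  by apply/measurable_EFinP; exact: L2_measurable p2.
by under eq_integral do rewrite /= ger0_norm//; rewrite weighted_ge0// ltry.
Qed.

(** The weight may be any version of the density: it is [u] for [mu], and [density] for the
    conditional laws. *)
Lemma Rintegral_weighted f : f \in L2 -> \int[m]_x f x = L2dot nu f h.
Proof.
move=> f2; have [p [q [p2 q2 p0 q0 ->]]] := L2_posneg f2.
rewrite RintegralB//; try exact: weighted_integrable.
by rewrite L2dotBl// /Rintegral !weighted_ge0.
Qed.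

End weighted.

(** * Expectations and conditional laws as scalar products *)

Section laws.
Context (R : realType) (n : nat) (dW : measure_display) (W : measurableType dW).
Context (Z : cadlag_markov_process R n W) (nu : probability (config n) R).
Context (nu_invariant : invariant_measure Z nu) (A : local_pattern n).
Implicit Types (f g : config n -> R) (F G : config n -> \bar R).
Local Notation L2 := (Lfun nu 2%:E).
Local Notation Kr := (killed_semigroup Z A).
Local Notation one := (cst (1 : R) : config n -> R).

Let two_times_ge0 t p q : 0 <= t -> p \in L2 -> q \in L2 ->
  (forall x, 0 <= p x) -> (forall x, 0 <= q x) ->
  (\int[init_law Z nu]_(w in survival Z A t)
     (p (state Z 0 w) * q (state Z t w))%:E = (L2dot nu p (Kr t q))%:E)%E.
Proof.
move=> t0 p2 q2 p0 q0.
have mP : measurable_fun setT (EFin \o p) by apply/measurable_EFinP; exact: L2_measurable p2.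
have mQ : measurable_fun setT (EFin \o q) by apply/measurable_EFinP; exact: L2_measurable q2.
have P0 x : (0 <= (EFin \o p) x)%E by rewrite lee_fin.
have Q0 x : (0 <= (EFin \o q) x)%E by rewrite lee_fin.
have mS := measurable_survival Z A t.
under eq_integral do rewrite EFinM.
rewrite (integral_two_times Z nu t mS P0 mP Q0 mQ).
have Kq2 := Kr_L2 nu_invariant A t0 q2.
rewrite L2dot_EFin//; apply: ge0_ae_eq_integral => //.
- by apply: emeasurable_funM => //; exact: (measurable_kill Z A t Q0 mQ).
- apply/measurable_EFinP; apply: measurable_funM; first exact: L2_measurable p2.
  exact: L2_measurable Kq2.
- by move=> x _; apply: mule_ge0 => //; exact: integral_ge0.
- by move=> x _; rewrite lee_fin mulr_ge0// Rintegral_ge0.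
- by apply: filterS (Kr_killE nu_invariant A t0 q2 q0) => x + _; rewrite EFinM => <-.
Qed.

Let mfX t f g : f \in L2 -> g \in L2 -> measurable_fun (survival Z A t)
  (EFin \o (fun w => f (state Z 0 w) * g (state Z t w))).
Proof.
move=> f2 g2; apply/measurable_EFinP; apply: measurable_funTS.
apply: measurable_funM; apply: measurableT_comp => //; first exact: L2_measurable f2.
exact: L2_measurable g2.
Qed.

Let int_two_times_ge0 t p q : 0 <= t -> p \in L2 -> q \in L2 ->
  (forall x, 0 <= p x) -> (forall x, 0 <= q x) ->
  (init_law Z nu).-integrable (survival Z A t)
     (EFin \o (fun w => p (state Z 0 w) * q (state Z t w))).
Proof.
move=> t0 p2 q2 p0 q0; apply/integrableP; split; first exact: mfX.
under eq_integral do rewrite /= ger0_norm ?mulr_ge0//.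
by rewrite two_times_ge0// ltry.
Qed.

Lemma Rintegral_two_times t f g : 0 <= t -> f \in L2 -> g \in L2 ->
  \int[init_law Z nu]_(w in survival Z A t) (f (state Z 0 w) * g (state Z t w)) =
  L2dot nu f (Kr t g).
Proof.
move=> t0 f2 g2; have mS := measurable_survival Z A t.
have half p g' : p \in L2 -> (forall x, 0 <= p x) -> g' \in L2 ->
    (init_law Z nu).-integrable (survival Z A t)
     (EFin \o (fun w => p (state Z 0 w) * g' (state Z t w))) /\
    \int[init_law Z nu]_(w in survival Z A t) (p (state Z 0 w) * g' (state Z t w)) =
     L2dot nu p (Kr t g').
  move=> p2 p0 g'2; have [c [e [c2 e2 c0 e0 ->]]] := L2_posneg g'2.
  have ic := int_two_times_ge0 t0 p2 c2 p0 c0.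
  have ie := int_two_times_ge0 t0 p2 e2 p0 e0.
  have Kc2 := Kr_L2 nu_invariant A t0 c2; have Ke2 := Kr_L2 nu_invariant A t0 e2.
  split.
    have := integrableB mS ic ie.
    by apply: eq_integrable => // w _ /=; rewrite mulrBr EFinB.
  under eq_Rintegral do rewrite mulrBr.
  rewrite RintegralB//.
  rewrite /Rintegral !two_times_ge0//= -L2dotBr// [LHS]L2dotC [RHS]L2dotC.
  apply/esym/L2dot_ae; last exact: KrB.
  - by apply: measurable_Kr; exact: L2_measurable (L2B c2 e2).
  - exact: L2_measurable (L2B Kc2 Ke2).
  - exact: L2_measurable p2.
have [a [b [a2 b2 a0 b0 ->]]] := L2_posneg f2.
have [ia Ea] := half a g a2 a0 g2; have [ib Eb] := half b g b2 b0 g2.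
under eq_Rintegral do rewrite mulrBl.
by rewrite RintegralB// Ea Eb L2dotBl//; exact: Kr_L2.
Qed.

Section initial_weight.
Context (pi : probability (config n) R) (h : config n -> R) (h2 : h \in L2).
Context (pih : forall F : config n -> \bar R, (forall x, (0 <= F x)%E) ->
  measurable_fun setT F -> (\int[pi]_x F x = \int[nu]_x (F x * (h x)%:E))%E).
Context (t : R) (t0 : 0 <= t).

Let kill_pi p : p \in L2 -> (forall x, 0 <= p x) ->
  (\int[pi]_x killed_transition Z A t (EFin \o p) x = (L2dot nu h (Kr t p))%:E)%E.
Proof.
move=> p2 p0; have P0 x : (0 <= (EFin \o p) x)%E by rewrite lee_fin.
have mP : measurable_fun setT (EFin \o p) by apply/measurable_EFinP; exact: L2_measurable p2.
have mK := measurable_kill Z A t P0 mP; have Kp2 := Kr_L2 nu_invariant A t0 p2.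
rewrite pih//; last by move=> x; exact: kill_ge0.
rewrite L2dot_EFin//; apply: ae_eq_integral => //.
- apply: emeasurable_funM => //; apply/measurable_EFinP; exact: L2_measurable h2.
- apply/measurable_EFinP; apply: measurable_funM; first exact: L2_measurable h2.
  exact: L2_measurable Kp2.
- by apply: filterS (Kr_killE nu_invariant A t0 p2 p0) => x -> _; rewrite -EFinM mulrC.
Qed.

(** Applied with weight 1 to [nu], and with its density to a general [pi]. *)
Lemma init_law_survival :
  init_law Z pi (survival Z A t) = (L2dot nu h (Kr t one))%:E.
Proof.
rewrite -kill_pi//; last exact: L2_cst.
apply: eq_integral => eta _; rewrite /killed_transition /= integral_cst ?mul1e//.
exact: measurable_survival.
Qed.

Context (surv_gt0 : (0 < init_law Z pi (survival Z A t))%E).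

Lemma ge0_integral_cond_law F : (forall x, (0 <= F x)%E) -> measurable_fun setT F ->
  (\int[cond_law Z A t pi]_x F x =
   ((L2dot nu h (Kr t one))^-1)%:E * \int[pi]_x killed_transition Z A t F x)%E.
Proof.
move=> F0 mF; have mS := measurable_survival Z A t.
rewrite ge0_integral_distribution//.
have := surv_gt0; rewrite init_law_survival lte_fin => e0.
have e0' : 0 <= (L2dot nu h (Kr t one))^-1 by rewrite invr_ge0 ltW.
have mFX := measurable_state_comp Z t mF.
rewrite (@eq_measure_integral _ _ _ _ (mscale (NngNum e0')
  (mrestr (init_law Z pi) (measurable_survival Z A t)))).
  rewrite ge0_integral_mscale//=.
  by rewrite ge0_integral_mrestr// ge0_integral_init_lawD.
have massE : mrestr (init_law Z pi) (measurable_survival Z A t) setT =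
    (L2dot nu h (Kr t one))%:E by rewrite /mrestr setTI init_law_survival.
(* The mass is abstracted in order to decide the test inside [mnormalize]; being positive and
   finite, it avoids the default branch. *)
have massP (e : \bar R) (U : set W) : e = (L2dot nu h (Kr t one))%:E ->
    (if (e == 0) || (e == +oo) then [eta init_law Z pi] else
      fun U => mrestr (init_law Z pi) (measurable_survival Z A t) U * ((fine e)^-1)%:E)%E U =
    mscale (NngNum e0') (mrestr (init_law Z pi) (measurable_survival Z A t)) U.
  by move=> ->; rewrite eqe gt_eqF//= /mscale /= muleC.
by move=> U mU _; exact: massP.
Qed.

Let cond_ge0 p : p \in L2 -> (forall x, 0 <= p x) ->
  (\int[cond_law Z A t pi]_x (p x)%:E =
   (L2dot nu h (Kr t p) / L2dot nu h (Kr t one))%:E)%E.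
Proof.
move=> p2 p0; rewrite ge0_integral_cond_law//.
- by rewrite kill_pi// -EFinM mulrC.
- by apply/measurable_EFinP; exact: L2_measurable p2.
Qed.

Let cond_integrable_ge0 p : p \in L2 -> (forall x, 0 <= p x) ->
  (cond_law Z A t pi).-integrable setT (EFin \o p).
Proof.
move=> p2 p0; apply/integrableP; split.
  by apply/measurable_EFinP; exact: L2_measurable p2.
by under eq_integral do rewrite /= ger0_norm//; rewrite cond_ge0// ltry.
Qed.

Lemma Rintegral_cond_law f : f \in L2 ->
  \int[cond_law Z A t pi]_x f x = L2dot nu h (Kr t f) / L2dot nu h (Kr t one).
Proof.
move=> f2; have [p [q [p2 q2 p0 q0 ->]]] := L2_posneg f2.
have Kp2 := Kr_L2 nu_invariant A t0 p2; have Kq2 := Kr_L2 nu_invariant A t0 q2.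
rewrite RintegralB//; try exact: cond_integrable_ge0.
rewrite /Rintegral !cond_ge0//= -mulrBl; congr (_ / _).
rewrite -L2dotBr// [LHS]L2dotC [RHS]L2dotC; apply/esym/L2dot_ae; last exact: KrB.
- by apply: measurable_Kr; exact: L2_measurable (L2B p2 q2).
- exact: L2_measurable (L2B Kp2 Kq2).
- exact: L2_measurable h2.
Qed.

(** For a null set [N], the killed transition of [\1_N] is nonnegative with integral at most [nu N],
    so it vanishes almost everywhere. *)
Lemma cond_law_dominated : cond_law Z A t pi `<< nu.
Proof.
apply/null_content_dominatesP => N mN N0.
have ind0 x : (0 <= (EFin \o \1_N) x :> \bar R)%E by rewrite lee_fin.
have mind : measurable_fun setT (EFin \o \1_N : config n -> \bar R).
  by apply/measurable_EFinP; exact: measurable_indic.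
have -> : (cond_law Z A t pi N = \int[cond_law Z A t pi]_x (EFin \o \1_N) x)%E.
  by rewrite integral_indic// setIT.
have K0 : {ae nu, forall x, killed_transition Z A t (EFin \o \1_N) x = 0}%E.
  have mK := measurable_kill Z A t ind0 mind.
  have [+ _] := ae_eq_integral_abs nu measurableT mK.
  move=> /(_ _)/wrap[|h']; last by apply: filterS h' => x /(_ I).
  under eq_integral do rewrite gee0_abs ?kill_ge0//.
  apply/eqP; rewrite eq_le integral_ge0 ?andbT//; last by move=> x _; exact: kill_ge0.
  apply: (le_trans (integral_kill_le nu_invariant A t0 ind0 mind)).
  by rewrite integral_indic// setIT; move/eqP: N0; rewrite eq_le => /andP[].
rewrite ge0_integral_cond_law// pih; last 2 first.
- by move=> x; exact: kill_ge0.
- exact: measurable_kill.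
rewrite (ae_eq_integral (cst 0))//= ?integral0 ?mule0//.
- apply: emeasurable_funM; first exact: measurable_kill.
  by apply/measurable_EFinP; exact: L2_measurable h2.
- by apply: filterS K0 => x -> _; rewrite mul0e.
Qed.

End initial_weight.

End laws.

(** * Decay of the killed semigroup *)

Section truncation.
Context (R : realType) d (T : measurableType d) (nu : probability T R).
Local Notation L2 := (Lfun nu 2%:E).

(** Truncation at height [k]: the squared error is dominated by [f^2] and vanishes at each point
    once [k >= |f x|]. *)
Lemma L2_bounded_dense f (e : R) : f \in L2 -> 0 < e ->
  exists g b, [/\ g \in L2, forall x, `|g x| <= b &
    L2nrm nu (fun x => f x - g x) < e].
Proof.
move=> f2 e0; have mf := L2_measurable f2.
pose g (k : nat) x := f x * \1_[set x | `|f x| <= k%:R] x.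
have mE k : measurable [set x | `|f x| <= k%:R].
  rewrite -[X in measurable X]setTI; apply: measurable_fun_le => //.
  exact: measurableT_comp.
have gE k x : g k x = if `|f x| <= k%:R then f x else 0.
  rewrite /g indicE (_ : (x \in _) = (`|f x| <= k%:R)); last first.
    by apply/idP/idP => [/set_mem//|h]; exact/mem_set.
  by case: ifP; rewrite ?mulr1 ?mulr0.
have mg k : measurable_fun setT (g k).
  by apply: measurable_funM => //; exact: measurable_indic.
have g2 k : g k \in L2.
  apply: (L2_le (mg k) f2) => x; rewrite gE; case: ifP => // _.
  by rewrite normr0.
have mfg k : measurable_fun setT (fun x => ((f x - g k x) ^+ 2)%:E).
  by apply/measurable_EFinP; apply: measurable_funX; exact: measurable_funB.
have m0 : measurable_fun [set: T] (cst 0%E : T -> \bar R) by [].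
have cvg0 : {ae nu, forall x, [set: T] x ->
    ((f x - g k x) ^+ 2)%:E @[k --> \oo] --> 0%E}.
  apply: aeW => x _; apply: cvg_near_cst.
  exists (Num.truncn `|f x|).+1 => // k /= kf.
  by rewrite gE ifT ?subrr ?expr0n// (le_trans (ltW (truncnS_gt _)))// ler_nat.
have dom : {ae nu, forall x k, [set: T] x ->
    (`|((f x - g k x) ^+ 2)%:E| <= (f x ^+ 2)%:E)%E}.
  apply: aeW => x k _; rewrite abse_EFin lee_fin ger0_norm ?sqr_ge0// gE.
  by case: ifP => _; rewrite ?subr0// subrr expr0n sqr_ge0.
have [_ _] := dominated_convergence measurableT mfg m0 cvg0
  (Lfun2_integrable_sqr f2) dom.
rewrite integral0 => /fine_cvgP[_ /cvgr0Pnorm_lt /(_ (e ^+ 2))].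
rewrite exprn_gt0// => /(_ isT)[k _ /(_ k (leqnn _))] /= h.
exists (g k), k%:R; split => //.
  by move=> x; rewrite gE; case: ifP => // _; rewrite normr0.
rewrite -(@ltr_pXn2r _ 2)// ?nnegrE ?L2nrm_ge0 ?ltW// L2nrm_sqr.
apply: le_lt_trans h; rewrite ger0_norm.
  by rewrite le_eqVlt; apply/orP; left; apply/eqP; apply: eq_Rintegral.
by apply: fine_ge0; apply: integral_ge0 => x _; rewrite lee_fin sqr_ge0.
Qed.

End truncation.

Section log_convexity.
Context (R : realType).

Lemma bernoulli (r : R) k : 1 <= r -> 1 + k%:R * (r - 1) <= r ^+ k.
Proof.
move=> r1; elim: k => [|k IH]; first by rewrite mul0r addr0 expr0.
rewrite exprS -natr1; have k0 : (0 : R) <= k%:R by [].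
have r0 : 0 <= r by lra.
apply: (@le_trans _ _ (r * (1 + k%:R * (r - 1)))); last by rewrite ler_wpM2l.
have := sqr_ge0 (r - 1); nra.
Qed.

(* With r := phi 0 / (x a) > 1, the hypothesis phi_k^2 <= a phi_(k+1) propagates to
   phi_k >= (r x)^(2^k) a, which outgrows the a priori bound of order x^(2^k). *)
Lemma log_convex_decay (phi : nat -> R) (a x D : R) : 0 <= a -> 0 < x ->
  (forall k, 0 <= phi k) -> (forall k, phi k ^+ 2 <= a * phi k.+1) ->
  (exists K, forall k, (K <= k)%N -> phi k ^+ 2 <= D * (x ^+ (2 ^ k)) ^+ 2) ->
  phi 0%N <= x * a.
Proof.
move=> a0 x0 phi_ge0 phiS [K0 up]; rewrite leNgt; apply/negP => lt0.
have {a0} a0 : 0 < a.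
  rewrite lt0r a0 andbT; apply/eqP => aE.
  have := phiS 0%N; rewrite aE mul0r => h.
  by move: lt0; rewrite aE mulr0 => h'; move: h; rewrite leNgt exprn_gt0.
have xa0 : 0 < x * a by rewrite mulr_gt0.
pose r := phi 0%N / (x * a).
have r1 : 1 < r by rewrite /r ltr_pdivlMr// mul1r.
have r0 : 0 < r by rewrite (lt_trans _ r1).
have rx0 : 0 <= r * x by rewrite ltW// mulr_gt0.
have rxa0 k : 0 <= (r * x) ^+ (2 ^ k) * a.
  by rewrite mulr_ge0 ?exprn_ge0//; exact: ltW.
have phi_ge k : (r * x) ^+ (2 ^ k) * a <= phi k.
  elim: k => [|k IH].
    by rewrite expn0 expr1 -mulrA /r divfK// gt_eqF.
  rewrite -(ler_pM2l a0) (le_trans _ (phiS k))//.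
  have -> : a * ((r * x) ^+ (2 ^ k.+1) * a) = ((r * x) ^+ (2 ^ k) * a) ^+ 2.
    by rewrite [RHS]exprMn -exprM -expnSr; ring.
  by rewrite lerXn2r ?nnegrE.
have d0 : 0 < (r - 1) * a ^+ 2 by rewrite mulr_gt0 ?exprn_gt0// subr_gt0.
(* Bernoulli's inequality gives [r ^ (2 ^ K) >= K (r - 1)], and this [K] makes [K (r - 1) a^2]
   exceed [|D|]. *)
pose K := maxn K0 (Num.truncn (`|D| / ((r - 1) * a ^+ 2))).+1.
have low : ((r * x) ^+ (2 ^ K) * a) ^+ 2 <= phi K ^+ 2.
  by rewrite lerXn2r ?nnegrE.
have := le_trans low (up K (leq_maxl _ _)).
have xK : 0 < (x ^+ (2 ^ K)) ^+ 2 by rewrite !exprn_gt0.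
have -> : ((r * x) ^+ (2 ^ K) * a) ^+ 2 =
    (r ^+ (2 ^ K)) ^+ 2 * a ^+ 2 * (x ^+ (2 ^ K)) ^+ 2.
  by rewrite !exprMn; ring.
rewrite ler_pM2r// leNgt => /negP; apply.
have rr : 1 <= r ^+ (2 ^ K) by rewrite exprn_ege1// ltW.
apply: (@lt_le_trans _ _ (K%:R * ((r - 1) * a ^+ 2))).
  rewrite (le_lt_trans (ler_norm _))// -ltr_pdivrMr//.
  by rewrite (lt_le_trans (truncnS_gt _))// ler_nat leq_maxr.
rewrite mulrA ler_pM2r ?exprn_gt0//.
apply: (@le_trans _ _ (r ^+ (2 ^ K))).
  apply: (le_trans _ (bernoulli _ (ltW r1))).
  rewrite -[leLHS]add0r lerD// ler_pM2r ?subr_gt0// ler_nat ltnW// ltn_expl//.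
by rewrite expr2 ler_peMr// (le_trans ler01).
Qed.

End log_convexity.

Section decay.
Context (R : realType) (n : nat) (dW : measure_display) (W : measurableType dW).
Context (Z : cadlag_markov_process R n W) (nu : probability (config n) R).
Context (nu_invariant : invariant_measure Z nu) (A : local_pattern n).
Context (sym : forall t (B C : set (config n)), 0 <= t -> measurable B -> measurable C ->
    init_law Z nu (state Z 0 @^-1` B `&` state Z t @^-1` C) =
    init_law Z nu (state Z 0 @^-1` C `&` state Z t @^-1` B)).
Implicit Types (f g : config n -> R).
Local Notation L2 := (Lfun nu 2%:E).
Local Notation Kr := (killed_semigroup Z A).
Local Notation one := (cst (1 : R) : config n -> R).
Local Notation nrm := (L2nrm nu).

Lemma Kr_dot f g s t : 0 <= s -> 0 <= t -> f \in L2 -> g \in L2 ->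
  L2dot nu (Kr s f) (Kr t g) = L2dot nu f (Kr (s + t) g).
Proof.
move=> s0 t0 f2 g2; have Kg2 := Kr_L2 nu_invariant A t0 g2.
have Kf2 := Kr_L2 nu_invariant A s0 f2.
transitivity (L2dot nu f (Kr s (Kr t g))).
  exact: esym (Kr_sym nu_invariant A sym s0 f2 Kg2).
rewrite L2dotC [RHS]L2dotC.
apply/esym/L2dot_ae; last exact: Kr_semigroup.
- by apply: measurable_Kr; exact: L2_measurable g2.
- by apply: measurable_Kr; exact: L2_measurable Kg2.
- exact: L2_measurable f2.
Qed.

(** Almost everywhere [|Kr t f| <= b Kr t 1], and the squared norm of [Kr t 1] is <1, K_2t 1>. *)
Lemma Kr_bounded f b t : 0 <= t -> f \in L2 -> (forall x, `|f x| <= b) ->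
  nrm (Kr t f) ^+ 2 <= b ^+ 2 * L2dot nu one (Kr (t + t) one).
Proof.
move=> t0 f2 fb; have one2 := L2_cst nu 1.
have K12 := Kr_L2 nu_invariant A t0 one2; have Kf2 := Kr_L2 nu_invariant A t0 f2.
have b0 : 0 <= b by rewrite (le_trans _ (fb point))// normr_ge0.
rewrite -Kr_dot// -L2nrm_sqr -exprMn lerXn2r ?nnegrE ?mulr_ge0 ?L2nrm_ge0//.
rewrite -(ger0_norm b0) -L2nrmZ// /L2nrm ler_sqrt ?L2dot_ge0// -lee_fin.
have bK2 := L2Z b K12; rewrite !L2dot_EFin//.
apply: ae_ge0_le_integral => //.
- by move=> x _; rewrite lee_fin -expr2 sqr_ge0.
- by apply/measurable_EFinP; apply: measurable_funM; exact: L2_measurable Kf2.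
- by move=> x _; rewrite lee_fin -expr2 sqr_ge0.
- by apply/measurable_EFinP; apply: measurable_funM; exact: L2_measurable bK2.
apply: filterS2 (ae_integrable_killed nu_invariant A t0 f2)
  (ae_integrable_killed nu_invariant A t0 one2) => x hf h1 _.
have mS := measurable_survival Z A t.
have K10 : 0 <= Kr t one x by apply: Rintegral_ge0.
have le : `|Kr t f x| <= b * Kr t one x.
  apply: (le_trans (le_normr_Rintegral mS hf)).
  rewrite -RintegralZl//; apply: le_Rintegral => //.
  - exact: integrable_norm.
  - have := integrableZl mS b h1.
    by apply: eq_integrable => // w _ /=; rewrite EFinM.
  - by move=> w _; rewrite mulr1.
rewrite lee_fin -!expr2 -[leLHS]ger0_norm ?sqr_ge0// normrX lerXn2r ?nnegrE//.
by rewrite mulr_ge0.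
Qed.

Context (lam C : R).
Context (surv_le : \forall t \near +oo,
  L2dot nu one (Kr t one) <= C * expR (- lam * t)).

Let ex t := expR (- lam * t).

(** [log_convex_decay] with [phi k] the norm of K f at time 2^k t and [x = ex t]; the a priori bound
    is [Kr_bounded] combined with [surv_le]. *)
Lemma Kr_decay_bounded f b t : 0 <= t -> f \in L2 -> (forall x, `|f x| <= b) ->
  nrm (Kr t f) <= ex t * nrm f.
Proof.
rewrite le_eqVlt => /orP[/eqP <- f2 _|t0 f2 fb].
  by rewrite /ex mulr0 expR0 mul1r Kr_contraction.
have p2k0 k : 0 <= (2 ^ k)%:R * t by rewrite mulr_ge0// ltW.
have K2 k : Kr ((2 ^ k)%:R * t) f \in L2 by exact: Kr_L2.
have := @log_convex_decay R (fun k => nrm (Kr ((2 ^ k)%:R * t) f)) (nrm f) (ex t)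
  (b ^+ 2 * C) (L2nrm_ge0 _ _) (expR_gt0 _) (fun k => L2nrm_ge0 _ _).
rewrite /= expn0 mul1r; apply.
  move=> k; rewrite L2nrm_sqr (Kr_dot (p2k0 k) (p2k0 k) f2 f2).
  rewrite -mulrDl -natrD addnn -mul2n -expnS.
  exact: le_trans (ler_norm _) (L2_CS f2 (K2 k.+1)).
have exX k : ex ((2 ^ k)%:R * t + (2 ^ k)%:R * t) = (ex t ^+ (2 ^ k)) ^+ 2.
  rewrite -exprM /ex -expRM_natl; congr expR.
  by rewrite natrM -mulrDl; ring.
have [M [Mreal hM]] := surv_le.
(* From this index on, 2^(k + 1) t exceeds the time [M] after which [surv_le] holds. *)
exists (Num.truncn (`|M| / t)).+1 => k Kk.
have h : M < k%:R * t.
  rewrite (le_lt_trans (ler_norm M))// -ltr_pdivrMr//.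
  by rewrite (lt_le_trans (truncnS_gt _))// ler_nat.
have h' : M < (2 ^ k)%:R * t + (2 ^ k)%:R * t.
  apply: (lt_le_trans h); apply: (@le_trans _ _ ((2 ^ k)%:R * t)).
    by rewrite ler_pM2r// ler_nat ltnW// ltn_expl.
  by rewrite lerDl.
apply: (le_trans (Kr_bounded (p2k0 k) f2 fb)); rewrite -exX -[leRHS]mulrA.
by apply: ler_wpM2l; [exact: sqr_ge0|exact: hM].
Qed.

(** The estimate for bounded functions does not involve their bound, so it passes to L^2 limits. *)
Lemma Kr_decay f t : 0 <= t -> f \in L2 -> nrm (Kr t f) <= ex t * nrm f.
Proof.
move=> t0 f2; apply/ler_addgt0Pr => e e0.
have x0 : 0 < ex t by exact: expR_gt0.
(* Replacing [f] by [g] costs |f - g| in the norm of [Kr t f] and [ex t] |f - g| in that of [f]. *)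
have d0 : 0 < e / (ex t + 1) by rewrite divr_gt0// addr_gt0.
have [g [b [g2 gb fg]]] := L2_bounded_dense f2 d0.
have fg2 := L2B f2 g2; have Kf2 := Kr_L2 nu_invariant A t0 f2.
have Kg2 := Kr_L2 nu_invariant A t0 g2.
have h1 := Kr_decay_bounded t0 g2 gb.
have h2 := Kr_contraction nu_invariant A t0 fg2.
have h3 : nrm g <= nrm f + nrm (fun x => f x - g x).
  have := L2nrm_triangle f2 (L2B g2 f2).
  rewrite (_ : (fun x => f x + (g x - f x)) = g); last first.
    by apply/funext => x; rewrite addrC subrK.
  by rewrite (L2nrmBC nu g f).
have h4 : nrm (Kr t f) <= nrm (Kr t g) + nrm (Kr t (fun x => f x - g x)).
  have Kfg2 := Kr_L2 nu_invariant A t0 fg2.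
  apply: le_trans (L2nrm_triangle Kg2 Kfg2).
  rewrite le_eqVlt; apply/orP; left; apply/eqP; apply: L2nrm_ae.
  - exact: L2_measurable Kf2.
  - exact: L2_measurable (L2D Kg2 Kfg2).
  - apply: filterS (KrB nu_invariant A t0 f2 g2) => x ->.
    by rewrite addrC subrK.
have : (ex t + 1) * nrm (fun x => f x - g x) <= e.
  by rewrite mulrC -ler_pdivlMr ?ltW// addr_gt0.
have := ler_wpM2l (ltW x0) h3; rewrite mulrDr mulrDl mul1r.
move: h1 h2 h4; move: (nrm _) (nrm _) (nrm _) (nrm _) (nrm _) (nrm _) => a1 a2 a3 a4 a5 a6.
lra.
Qed.

End decay.

(** * Convergence of symmetric contraction semigroups to a fixed point *)

Section symmetric_contractions.
Context (R : realType) d (T : measurableType d) (nu : probability T R).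
Local Notation L2 := (Lfun nu 2%:E).
Local Notation nrm := (L2nrm nu).
Context (M : R -> (T -> R) -> T -> R).
Context (M_L2 : forall t f, 0 <= t -> f \in L2 -> M t f \in L2).
Context (M_sym : forall t f g, 0 <= t -> f \in L2 -> g \in L2 ->
  L2dot nu f (M t g) = L2dot nu (M t f) g).
Context (M_dot : forall s t f g, 0 <= s -> 0 <= t -> f \in L2 -> g \in L2 ->
  L2dot nu (M s f) (M t g) = L2dot nu f (M (s + t) g)).
Context (M_le : forall t f, 0 <= t -> f \in L2 -> nrm (M t f) <= nrm f).
Context (M_nincr : forall s t f, 0 <= s -> 0 <= t -> f \in L2 ->
  nrm (M (s + t) f) <= nrm (M s f)).

(* |M_s f - M_t f|^2 = B s + B t - 2 B ((s + t) / 2) with B t = |M_t f|^2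
   nonincreasing. *)
Lemma contraction_cauchy f e : f \in L2 -> 0 < e -> exists2 t0, 0 <= t0 &
  forall s t, t0 <= s -> t0 <= t -> nrm (fun x => M s f x - M t f x) <= e.
Proof.
move=> f2 e0; pose E := [set y | exists2 t, 0 <= t & y = nrm (M t f) ^+ 2].
have infE : has_inf E.
  split; first by exists (nrm (M 0 f) ^+ 2); exists 0.
  by exists 0 => _ [t _ ->]; exact: sqr_ge0.
(* Two values of B within [e^2 / 2] of its infimum, minus twice the infimum, leave at most [e^2]. *)
have d0 : 0 < e ^+ 2 / 2 by rewrite divr_gt0// exprn_gt0.
have [_ [t0 t00 ->] t0E] := inf_adherent d0 infE.
exists t0 => // s t ts tt.
have s0 := le_trans t00 ts; have t1 := le_trans t00 tt.
have Ms2 := M_L2 s0 f2; have Mt2 := M_L2 t1 f2.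
have ub r : t0 <= r -> nrm (M r f) ^+ 2 <= nrm (M t0 f) ^+ 2.
  move=> tr; rewrite lerXn2r ?nnegrE ?L2nrm_ge0// -[X in M X f](subrKC t0).
  by apply: M_nincr => //; rewrite subr_ge0.
have lb r : 0 <= r -> inf E <= nrm (M r f) ^+ 2.
  by move=> r0; apply: ge_inf; [exact: infE.2|exists r].
have mid0 : 0 <= (s + t) / 2 by rewrite divr_ge0// addr_ge0.
have st : L2dot nu (M s f) (M t f) = nrm (M ((s + t) / 2) f) ^+ 2.
  by rewrite L2nrm_sqr !M_dot// -splitr.
rewrite -(@ler_pXn2r _ 2)// ?nnegrE ?L2nrm_ge0 ?(ltW e0)//.
have -> : nrm (fun x => M s f x - M t f x) ^+ 2 =
    nrm (M s f) ^+ 2 + nrm (M t f) ^+ 2 - 2 * nrm (M ((s + t) / 2) f) ^+ 2.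
  rewrite -st !L2nrm_sqr L2dotBl//; last exact: L2B.
  by rewrite !L2dotBr// (L2dotC nu (M t f)); ring.
have := ub s ts; have := ub t tt; have := lb _ mid0; lra.
Qed.

Lemma contraction_limit f : f \in L2 -> exists F, [/\ F \in L2,
  forall e, 0 < e -> exists2 t0, 0 <= t0 &
    forall t, t0 <= t -> nrm (fun x => M t f x - F x) <= e &
  forall t, 0 <= t -> {ae nu, forall x, M t F x = F x}].
Proof.
move=> f2.
have eps0 k : (0 : R) < ((2 ^ k)%:R)^-1 by rewrite invr_gt0 ltr0n expn_gt0.
have /choice[T0 hT] k : exists t0, 0 <= t0 /\ forall s t, t0 <= s -> t0 <= t ->
    nrm (fun x => M s f x - M t f x) <= ((2 ^ k)%:R)^-1.
  by have [t0 t00 h] := contraction_cauchy f2 (eps0 k); exists t0.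
(* Partial sums, so that the times increase and stay beyond each [T0 k]. *)
pose tk k := \sum_(j < k.+1) T0 j.
have T00 k : 0 <= T0 k by have [] := hT k.
have tk_ge k : T0 k <= tk k by rewrite /tk big_ord_recr/= lerDr sumr_ge0.
have tk_S k : tk k <= tk k.+1 by rewrite /tk [leRHS]big_ord_recr/= lerDl.
have tk0 k : 0 <= tk k by rewrite (le_trans (T00 k)).
have fk2 k : M (tk k) f \in L2 by exact: M_L2.
have fast k : nrm (fun x => M (tk k.+1) f x - M (tk k) f x) <= ((2 ^ k)%:R)^-1.
  by apply: (hT k).2 => //; exact: le_trans (tk_S k).
have [F F2 hF] := L2_fast_cauchy_cvg fk2 fast.
have lim e : 0 < e -> exists2 t0, 0 <= t0 &
    forall t, t0 <= t -> nrm (fun x => M t f x - F x) <= e.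
  (* The 3 is 1 for the Cauchy bound between [t] and [tk k], plus 2 for the distance from
     [M (tk k) f] to [F]. *)
  move=> e0; pose k := (Num.truncn (3 / e)).+1.
  have ke : 3 * ((2 ^ k)%:R)^-1 <= e.
    rewrite ler_pdivrMr ?ltr0n ?expn_gt0// mulrC -ler_pdivrMr// ltW//.
    by rewrite (lt_le_trans (truncnS_gt _))// ler_nat ltnW// ltn_expl.
  exists (T0 k) => // t Tt; apply: le_trans ke.
  have t0 := le_trans (T00 k) Tt.
  have := L2nrm_triangleB (M_L2 t0 f2) (fk2 k) F2.
  have := (hT k).2 t (tk k) Tt (tk_ge k); have := hF k; lra.
exists F; split => // s s0.
have MF2 := M_L2 s0 F2.
(* The semigroup law of [M] is given through scalar products, so the fixed point equation is tested
   against [g], with [M s] moved onto [g]. *)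
have weak g : g \in L2 -> L2dot nu (M s F) g = L2dot nu F g.
  move=> g2; have Mg2 := M_L2 s0 g2.
  apply/eqP; rewrite -subr_eq0 -normr_le0; apply/ler_addgt0Pr => e e0; rewrite add0r.
  have C0 : 0 < 2 * nrm g + 1 by rewrite ltr_wpDl// mulr_ge0// L2nrm_ge0.
  have [t0 t00 ht] := lim _ (divr_gt0 e0 C0).
  have h1 := ht t0 (lexx _).
  have st0 : t0 <= s + t0 by rewrite lerDr.
  have h2 := ht (s + t0) st0.
  have Mt2 := M_L2 t00 f2; have Mst2 := M_L2 (addr_ge0 s0 t00) f2.
  have -> : L2dot nu (M s F) g - L2dot nu F g =
      L2dot nu (fun x => M (s + t0) f x - F x) g -
      L2dot nu (fun x => M t0 f x - F x) (M s g).
    rewrite !L2dotBl// -M_sym// M_dot// -(M_sym (addr_ge0 s0 t00))//.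
    by rewrite (addrC t0 s); ring.
  rewrite (le_trans (ler_normB _ _))//.
  have b1 := L2_CS (L2B Mst2 F2) g2.
  have b2 := L2_CS (L2B Mt2 F2) Mg2.
  have b3 := ler_pM (L2nrm_ge0 nu _) (L2nrm_ge0 nu _) h2 (lexx (nrm g)).
  have b4 := ler_pM (L2nrm_ge0 nu _) (L2nrm_ge0 nu _) h1 (M_le s0 g2).
  have b5 : e / (2 * nrm g + 1) * (2 * nrm g + 1) = e by rewrite divfK// gt_eqF.
  have b6 : 0 <= e / (2 * nrm g + 1) by rewrite ltW// divr_gt0.
  apply: (le_trans (lerD (le_trans b1 b3) (le_trans b2 b4))).
  rewrite -[leRHS]b5 (_ : _ * (2 * nrm g + 1) = e / (2 * nrm g + 1) * nrm g +
    e / (2 * nrm g + 1) * nrm g + e / (2 * nrm g + 1)); last by ring.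
  by rewrite lerDl.
have d2 := L2B MF2 F2.
have d0 : nrm (fun x => M s F x - F x) = 0.
  apply/eqP; rewrite -sqrf_eq0 L2nrm_sqr L2dotBl//; apply/eqP.
  by rewrite weak// subrr.
by apply: filterS (L2nrm_eq0 d2 d0) => x /eqP; rewrite subr_eq0 => /eqP.
Qed.

End symmetric_contractions.

(** * Long-time behaviour *)

Section long_time.
Context (R : realType) (n : nat) (dW : measure_display) (W : measurableType dW).
Context (Z : cadlag_markov_process R n W) (nu : probability (config n) R).
Context (nu_invariant : invariant_measure Z nu) (A : local_pattern n).
Context (sym : forall t (B C : set (config n)), 0 <= t -> measurable B -> measurable C ->
    init_law Z nu (state Z 0 @^-1` B `&` state Z t @^-1` C) =
    init_law Z nu (state Z 0 @^-1` C `&` state Z t @^-1` B)).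
Implicit Types (f g : config n -> R).
Local Notation L2 := (Lfun nu 2%:E).
Local Notation Kr := (killed_semigroup Z A).
Local Notation one := (cst (1 : R) : config n -> R).
Local Notation nrm := (L2nrm nu).
Context (lam C : R).
Context (surv_le : \forall t \near +oo,
  L2dot nu one (Kr t one) <= C * expR (- lam * t)).

Let M t f : config n -> R := fun x => expR (lam * t) * Kr t f x.

Let M_L2 t f : 0 <= t -> f \in L2 -> M t f \in L2.
Proof. by move=> t0 f2; exact: L2Z (Kr_L2 nu_invariant A t0 f2). Qed.

Let M_sym t f g : 0 <= t -> f \in L2 -> g \in L2 ->
  L2dot nu f (M t g) = L2dot nu (M t f) g.
Proof.
move=> t0 f2 g2; have Kf2 := Kr_L2 nu_invariant A t0 f2.
have Kg2 := Kr_L2 nu_invariant A t0 g2.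
by rewrite (L2dotZr _ Kg2 f2) (L2dotZl _ Kf2 g2) (Kr_sym nu_invariant A sym t0 f2 g2).
Qed.

Let M_dot s t f g : 0 <= s -> 0 <= t -> f \in L2 -> g \in L2 ->
  L2dot nu (M s f) (M t g) = L2dot nu f (M (s + t) g).
Proof.
move=> s0 t0 f2 g2; have Kf2 := Kr_L2 nu_invariant A s0 f2.
have Kg2 := Kr_L2 nu_invariant A t0 g2.
have Kst2 := Kr_L2 nu_invariant A (addr_ge0 s0 t0) g2.
rewrite (L2dotZr _ Kg2 (M_L2 s0 f2)) (L2dotZl _ Kf2 Kg2) (L2dotZr _ Kst2 f2).
by rewrite (Kr_dot nu_invariant A sym s0 t0 f2 g2) mulrDr expRD mulrA (mulrC (expR _)).
Qed.

Let M_le t f : 0 <= t -> f \in L2 -> nrm (M t f) <= nrm f.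
Proof.
move=> t0 f2; have Kf2 := Kr_L2 nu_invariant A t0 f2.
rewrite (L2nrmZ _ Kf2) (gtr0_norm (expR_gt0 _)).
have h := Kr_decay nu_invariant sym surv_le t0 f2.
apply: (le_trans (ler_wpM2l (expR_ge0 _) h)).
by rewrite mulrA -expRD mulNr subrr expR0 mul1r.
Qed.

Let M_nincr s t f : 0 <= s -> 0 <= t -> f \in L2 ->
  nrm (M (s + t) f) <= nrm (M s f).
Proof.
move=> s0 t0 f2; have Kf2 := Kr_L2 nu_invariant A s0 f2.
have Ms2 := M_L2 s0 f2; have Mst2 := M_L2 (addr_ge0 s0 t0) f2.
have MMs2 := M_L2 t0 Ms2.
apply: le_trans (M_le t0 Ms2).
rewrite le_eqVlt; apply/orP; left; apply/eqP.
apply: (L2nrm_ae (L2_measurable Mst2) (L2_measurable MMs2)).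
apply: filterS2 (Kr_semigroup nu_invariant A t0 s0 f2)
  (KrZ nu_invariant A (expR (lam * s)) t0 Kf2) => x h1 h2.
by rewrite /M h2 -h1 mulrDr expRD (addrC t s); ring.
Qed.

Context (u : config n -> R) (u_simple : simple_eigenfunction Z nu A lam u).

Lemma eigenfunction_nrm_gt0 : 0 < L2dot nu u u.
Proof.
have [[u2 _] u_neq0 _] := u_simple; rewrite -L2nrm_sqr exprn_gt0//.
rewrite lt0r L2nrm_ge0 andbT; apply/eqP => u0; apply: u_neq0.
exact: L2nrm_eq0 u2 u0.
Qed.

Lemma killed_semigroup_cvg f g : f \in L2 -> g \in L2 ->
  expR (lam * t) * L2dot nu f (Kr t g) @[t --> +oo] -->
  L2dot nu f u * L2dot nu g u / L2dot nu u u.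
Proof.
move=> f2 g2; have [[u2 u_eigen] _ u_uniq] := u_simple.
have [F [F2 lim MF]] := contraction_limit M_L2 M_sym M_dot M_le M_nincr g2.
have [c Fc] : exists c : R, {ae nu, forall x, F x = c * u x}.
  apply: u_uniq; split => // t t0.
  apply: filterS (MF t t0) => x; rewrite /M => h.
  by rewrite -[in RHS]h mulrA -expRD mulNr addNr expR0 mul1r.
have Mu t : 0 <= t -> {ae nu, forall x, M t u x = u x}.
  move=> t0; apply: filterS (u_eigen t t0) => x h.
  by rewrite /M h mulrA -expRD mulNr subrr expR0 mul1r.
have near_F k e : k \in L2 -> 0 < e -> exists2 t0, 0 <= t0 & forall t, t0 <= t ->
    `|L2dot nu k F - L2dot nu k (M t g)| <= e.
  move=> k2 e0; have k0 : 0 < nrm k + 1 by rewrite ltr_wpDl// L2nrm_ge0.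
  have [t0 t00 h] := lim _ (divr_gt0 e0 k0).
  exists t0 => // t tt; have t1 := le_trans t00 tt; have Mg2 := M_L2 t1 g2.
  rewrite -L2dotBr// (le_trans (L2_CS k2 (L2B F2 Mg2)))// L2nrmBC.
  apply: (le_trans (ler_wpM2l (L2nrm_ge0 nu k) (h t tt))).
  rewrite mulrA ler_pdivrMr// mulrDr mulr1 mulrC lerDl ltW//.
(* The scalar product of [u] with [M t g] does not depend on [t], because [M t u = u]; this
   determines the coefficient [c]. *)
have Fu : L2dot nu u F = L2dot nu g u.
  apply/eqP; rewrite -subr_eq0 -normr_le0; apply/ler_addgt0Pr => e e0; rewrite add0r.
  have [t0 t00 h] := near_F u e u2 e0.
  have := h t0 (lexx _); rewrite M_sym//.
  rewrite (L2dot_ae (L2_measurable (M_L2 t00 u2)) (L2_measurable u2) (L2_measurable g2) (Mu t0 t00)).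
  by rewrite (L2dotC nu u g).
have cu2 := L2Z c u2.
have FE k : k \in L2 -> L2dot nu k F = c * L2dot nu k u.
  move=> k2; rewrite L2dotC.
  rewrite (L2dot_ae (L2_measurable F2) (L2_measurable cu2) (L2_measurable k2) Fc).
  by rewrite (L2dotZl c u2 k2) (L2dotC nu u k).
have uu0 := eigenfunction_nrm_gt0.
have -> : L2dot nu f u * L2dot nu g u / L2dot nu u u = L2dot nu f F.
  by rewrite FE// -Fu FE//; field; rewrite gt_eqF.
apply/cvgrPdist_le => e e0; have [t0 t00 h] := near_F f e f2 e0.
near=> t.
have tt0 : t0 <= t by near: t; exact/nbhs_pinfty_ge/num_real.
have := h t tt0; rewrite /M (L2dotZr _ (Kr_L2 nu_invariant A (le_trans t00 tt0) g2) f2).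
by [].
Unshelve. all: by end_near. Qed.

End long_time.

(** * The survival probability under the Yaglom limit *)

Section yaglom.
Context (R : realType) (n : nat) (dW : measure_display) (W : measurableType dW).
Context (Z : cadlag_markov_process R n W) (nu : probability (config n) R).
Context (A : local_pattern n) (mu : probability (config n) R).
Context (lam : R) (u : config n -> R).
Context (nu_invariant : invariant_measure Z nu).
Context (mu_dominated : mu `<< nu).
Context (u_density : {ae nu, forall eta, u eta = density nu mu eta}).
Context (u_simple : simple_eigenfunction Z nu A lam u).
Local Notation L2 := (Lfun nu 2%:E).
Local Notation Kr := (killed_semigroup Z A).
Local Notation one := (cst (1 : R) : config n -> R).

Let u2 : u \in L2. Proof. by have [[]] := u_simple. Qed.

Let one2 : one \in L2. Proof. exact: L2_cst. Qed.

Lemma Rintegral_mu f : f \in L2 -> \int[mu]_x f x = L2dot nu f u.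
Proof.
apply: (Rintegral_weighted u2) => F F0 mF.
rewrite (ge0_integral_density mu_dominated F0 mF); apply: ae_eq_integral => //.
- apply: emeasurable_funM => //; apply/measurable_EFinP.
  exact: measurable_density.
- by apply: emeasurable_funM => //; apply/measurable_EFinP; exact: L2_measurable u2.
- by apply: filterS u_density => x -> _.
Qed.

Lemma L2dot_one_u : L2dot nu one u = 1.
Proof.
rewrite -Rintegral_mu// Rintegral_cst// mul1r -[RHS]/(fine 1%E).
by congr fine; exact: probability_setT.
Qed.

Lemma u_ge0 : {ae nu, forall x, 0 <= u x}.
Proof. by apply: filterS2 u_density (density_ge0 mu_dominated) => x -> . Qed.

Let one_weight (F : config n -> \bar R) : (forall x, (0 <= F x)%E) ->
  measurable_fun setT F -> (\int[nu]_x F x = \int[nu]_x (F x * (one x)%:E))%E.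
Proof. by move=> _ _; apply: eq_integral => x _; rewrite mule1. Qed.

Lemma init_law_nu_survival t : 0 <= t ->
  init_law Z nu (survival Z A t) = (L2dot nu one (Kr t one))%:E.
Proof. by move=> t0; exact: (init_law_survival nu_invariant A one2 one_weight t0). Qed.

Let one_Kr_u t : 0 <= t -> L2dot nu one (Kr t u) = expR (- lam * t).
Proof.
move=> t0; have [[_ u_eigen] _ _] := u_simple.
have eu2 := L2Z (expR (- lam * t)) u2.
rewrite L2dotC (L2dot_ae (L2_measurable (Kr_L2 nu_invariant A t0 u2))
  (L2_measurable eu2) (L2_measurable one2) (u_eigen t t0)).
by rewrite (L2dotZl _ u2 one2) L2dotC L2dot_one_u mulr1.
Qed.

Context (sym : forall t (B C : set (config n)), 0 <= t -> measurable B -> measurable C ->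
    init_law Z nu (state Z 0 @^-1` B `&` state Z t @^-1` C) =
    init_law Z nu (state Z 0 @^-1` C `&` state Z t @^-1` B)).

(** It equals the squared norm of [Kr (t / 2) 1], whose scalar product with [u] is exp(- lam t / 2),
    hence nonzero. *)
Lemma survival_gt0 t : 0 <= t -> 0 < L2dot nu one (Kr t one).
Proof.
move=> t0; have s0 : 0 <= t / 2 by rewrite divr_ge0.
have Ks2 := Kr_L2 nu_invariant A s0 one2.
have -> : L2dot nu one (Kr t one) = L2nrm nu (Kr (t / 2) one) ^+ 2.
  by rewrite L2nrm_sqr (Kr_dot nu_invariant A sym s0 s0 one2 one2) -splitr.
rewrite exprn_gt0// lt0r L2nrm_ge0 andbT; apply/eqP => K0.
have := L2_CS Ks2 u2; rewrite K0 mul0r -(Kr_sym nu_invariant A sym s0 one2 u2).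
by rewrite one_Kr_u// normr_le0 gt_eqF// expR_gt0.
Qed.

Context (density_cvg :
  L2norm nu (density nu (cond_law Z A t nu) \- u) @[t --> +oo] --> 0%E).

(* <dT_t(nu)/dnu, u> = exp (- lam t) / P_nu(tau > t), and the left-hand side tends
   to |u|^2. *)
Lemma survival_decay : exists C, \forall t \near +oo,
  L2dot nu one (Kr t one) <= C * expR (- lam * t).
Proof.
have uu0 := eigenfunction_nrm_gt0 u_simple.
have nu0 : 0 < L2nrm nu u.
  by rewrite /L2nrm sqrtr_gt0.
(* Once the density is within |u| / 2 of [u], its scalar product with [u] is at least |u|^2 / 2. *)
exists (2 / L2dot nu u u).
have e0 : 0 < L2nrm nu u / 2 by rewrite divr_gt0.
have /fine_cvgP[fin /cvgr0Pnorm_lt /(_ _ e0) close] := density_cvg.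
near=> t.
have t0 : 0 <= t by near: t; exact/nbhs_pinfty_ge/num_real.
have p0 := survival_gt0 t0.
have surv0 : (0 < init_law Z nu (survival Z A t))%E by rewrite init_law_nu_survival.
have dom := cond_law_dominated nu_invariant one2 one_weight t0 surv0.
have mD := measurable_density dom.
have mu' := L2_measurable u2.
(* Convergence of the norms to 0 makes them finite for large [t], which puts the density itself in
   L^2. *)
have d2 : (density nu (cond_law Z A t nu) \- u)%R \in L2.
  rewrite inE; apply/andP; split; rewrite inE; first exact: measurable_funB.
  rewrite /= /finite_norm ltey_eq; apply/orP; left.
  by near: t.
have D2 : density nu (cond_law Z A t nu) \in L2.
  rewrite (_ : density _ _ = fun x => (density nu (cond_law Z A t nu) \- u) x + u x).
    exact: L2D.
  by apply/funext => x /=; rewrite subrK.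
have small : L2nrm nu (density nu (cond_law Z A t nu) \- u) < L2nrm nu u / 2.
  have : `|fine (L2norm nu (density nu (cond_law Z A t nu) \- u))| < L2nrm nu u / 2.
    by near: t.
  by rewrite L2norm_EFin//= ger0_norm// L2nrm_ge0.
have uD : L2dot nu u (density nu (cond_law Z A t nu)) =
    expR (- lam * t) / L2dot nu one (Kr t one).
  rewrite -(Rintegral_weighted D2 (ge0_integral_density dom) u2).
  rewrite (Rintegral_cond_law nu_invariant one2 one_weight t0 surv0 u2).
  by rewrite one_Kr_u.
have := L2_CS u2 d2; rewrite (L2dotBr D2 u2 u2) uD => cs.
have half : L2dot nu u u / 2 <= expR (- lam * t) / L2dot nu one (Kr t one).
  have h1 : L2nrm nu u * L2nrm nu (density nu (cond_law Z A t nu) \- u) <= L2dot nu u u / 2.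
    by rewrite -L2nrm_sqr expr2 -mulrA ler_pM2l// ltW.
  have := le_trans cs h1; rewrite ler_norml => /andP[+ _]; 
  by move: (L2dot nu u u) (expR _ / _) => a b; lra.
move: half; rewrite ler_pdivlMr// => half.
rewrite mulrAC ler_pdivlMr//; move: half; move: (expR _) (L2dot nu u u) (L2dot _ _ _) => a b c.
lra.
Unshelve. all: by end_near. Qed.

End yaglom.

Unset Implicit Arguments.

Theorem proposition1p8 (R : realType) (n : nat) (dW : measure_display)
    (W : measurableType dW) (Z : cadlag_markov_process R n W)
    (nu : probability (config n) R) (A : local_pattern n)
    (mu : probability (config n) R) (lam : R) (u : config n -> R)
    (nu_invariant : invariant_measure Z nu)
    (generator_self_adjoint : L2_self_adjoint nu (generator Z nu))
    (yaglom_limit : forall f : config n -> R, continuous f ->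
       (\int[cond_law Z A t nu]_eta f eta) @[t --> +oo] -->
       \int[mu]_eta f eta)
    (lam_gt0 : 0 < lam)
    (lam_rate :
       - (ln (fine (init_law Z nu (survival Z A t))) / t) @[t --> +oo] --> lam)
    (mu_dominated : mu `<< nu)
    (u_density : {ae nu, forall eta, u eta = density nu mu eta})
    (u_L2 : u \in Lfun nu 2%:E)
    (u_simple : simple_eigenfunction Z nu A lam u)
    (u_positive : {ae nu, forall eta, ~ pattern A eta -> 0 < u eta})
    (density_cvg :
       L2norm nu (density nu (cond_law Z A t nu) \- u) @[t --> +oo] --> 0%E) :
  (forall f g : config n -> R, f \in Lfun nu 2%:E -> g \in Lfun nu 2%:E ->
     (\int[init_law Z nu]_(w in survival Z A t)
         (f (state Z 0 w) * g (state Z t w)))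
       / fine (init_law Z nu (survival Z A t)) @[t --> +oo] -->
     (\int[mu]_eta f eta) * (\int[mu]_eta g eta))
  /\
  (forall pi : probability (config n) R,
     pi `<< nu -> density nu pi \in Lfun nu 2%:E ->
     (forall t, 0 <= t -> (0 < init_law Z pi (survival Z A t))%E) ->
     forall f : config n -> R, f \in Lfun nu 2%:E ->
       (\int[cond_law Z A t pi]_eta f eta) @[t --> +oo] -->
       \int[mu]_eta f eta).
Proof.
have sym := reversible nu_invariant generator_self_adjoint.
pose one : config n -> R := cst 1.
pose Kr := killed_semigroup Z A.
have one2 : one \in Lfun nu 2%:E by exact: L2_cst.
have [C surv_le] := survival_decay nu_invariant mu_dominated u_density u_simple
  sym density_cvg.
have lim f g f2 g2 := @killed_semigroup_cvg R n dW W Z nu nu_invariant A sym lam C surv_le u u_simple f g f2 g2.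
have uu0 := eigenfunction_nrm_gt0 u_simple.
have ou : L2dot nu one u = 1 := L2dot_one_u mu_dominated u_density u_simple.
have muE f f2 := @Rintegral_mu R n dW W Z nu A mu lam u mu_dominated u_density u_simple f f2.
(* Claim (i) is the case [h = 1]; claim (ii) takes the density of [pi] for both [f] and [h]. The
   factors exp(lam t) and |u|^2 cancel. *)
have ratio f g h : f \in Lfun nu 2%:E -> g \in Lfun nu 2%:E -> h \in Lfun nu 2%:E ->
    L2dot nu h u != 0 ->
    L2dot nu f (Kr t g) / L2dot nu h (Kr t one) @[t --> +oo] -->
    L2dot nu f u * L2dot nu g u / L2dot nu h u.
  move=> f2 g2 h2 hu0.
  have -> : (fun t => L2dot nu f (Kr t g) / L2dot nu h (Kr t one)) =
      (fun t => (expR (lam * t) * L2dot nu f (Kr t g)) /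
                (expR (lam * t) * L2dot nu h (Kr t one))).
    by apply/funext => t; rewrite -mulf_div divff ?mul1r// gt_eqF// expR_gt0.
  have -> : L2dot nu f u * L2dot nu g u / L2dot nu h u =
      (L2dot nu f u * L2dot nu g u / L2dot nu u u) /
      (L2dot nu h u * L2dot nu one u / L2dot nu u u).
    by rewrite ou; field; rewrite hu0 gt_eqF.
  apply: cvgM; first exact: lim.
  apply: cvgV; last exact: lim.
  by rewrite ou mulr1 mulf_neq0// invr_eq0 gt_eqF.
split.
  move=> f g f2 g2; rewrite !muE//.
  have := ratio f g one f2 g2 one2; rewrite ou oner_eq0 divr1 => /(_ isT).
  apply: cvg_trans; apply: near_eq_cvg; near=> t.
  have t0 : 0 <= t by near: t; exact/nbhs_pinfty_ge/num_real.
  by rewrite (Rintegral_two_times nu_invariant A t0 f2 g2) (init_law_nu_survival A nu_invariant t0).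
move=> pi pi_dominated h2 surv_pi f f2.
set h := density nu pi in h2.
have piE := ge0_integral_density pi_dominated.
have hKr t : 0 <= t -> 0 < L2dot nu h (Kr t one).
  move=> t0; have := surv_pi t t0.
  by rewrite (init_law_survival nu_invariant A h2 piE t0).
(* Otherwise [h u = 0] almost everywhere, so [h = 0] off the pattern, where [u > 0]. As [Kr 0 1] is
   the indicator of the complement of the pattern, P_pi(tau > 0) would be 0. *)
have hu0 : L2dot nu h u != 0.
  apply/eqP => hu.
  have h0 := density_ge0 pi_dominated; have u0 := u_ge0 mu_dominated u_density.
  have mh := L2_measurable h2; have mu' := L2_measurable u_L2.
  have mhu : measurable_fun setT (fun x => (h x * u x)%:E).
    by apply/measurable_EFinP; exact: measurable_funM.
  have hu_ae : {ae nu, forall x, h x * u x = 0}.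
    have [H _] := ae_eq_integral_abs nu measurableT mhu.
    apply: filterS (H _) => [x /(_ I) [] //|].
    rewrite -[RHS]/(0%:E) -hu L2dot_EFin//; apply: ae_eq_integral => //.
      exact: measurableT_comp.
    by apply: filterS2 h0 u0 => x h0 u0 _; rewrite abse_EFin ger0_norm// mulr_ge0.
  have := hKr 0 (lexx _); rewrite /Kr.
  have -> : L2dot nu h (killed_semigroup Z A 0 one) = L2dot nu (cst 0) one.
    rewrite L2dotC [RHS]L2dotC /L2dot; congr fine.
    have mind : measurable_fun setT (\1_(~` pattern A) : config n -> R).
      by apply: measurable_indic; apply: measurableC; exact: measurable_pattern.
    apply: ae_eq_integral => //.
    - apply/measurable_EFinP; apply: measurable_funM => //.
      by apply: measurable_Kr.
    - by apply/measurable_EFinP; exact: measurable_funM.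
    - apply: filterS2 hu_ae u_positive => x hx ux _; congr EFin.
      rewrite killed_semigroup0// mul1r /= mulr0 indicE.
      have [xA|xA] := boolP (x \in ~` pattern A); last by rewrite mul0r.
      move/set_mem: xA => /ux ux0; move/eqP: hx; rewrite mulf_eq0 (gt_eqF ux0) orbF.
      by move=> /eqP ->; rewrite mulr0.
  rewrite /L2dot; under eq_Rintegral do rewrite mul0r.
  by rewrite Rintegral_cst// mul0r ltxx.
rewrite muE//.
(* The factor <h, u> appears in both numerator and denominator of the limit, which is therefore
   independent of [pi]. *)
have := ratio h f h h2 f2 h2 hu0.
rewrite mulrAC divff// mul1r.
apply: cvg_trans; apply: near_eq_cvg; near=> t.
have t0 : 0 <= t by near: t; exact/nbhs_pinfty_ge/num_real.
by rewrite (Rintegral_cond_law nu_invariant h2 piE t0 (surv_pi t t0) f2).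
Unshelve. all: by end_near. Qed.
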